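(* Let $k\ge1$, $n_0\ge0$ be integers, $0<\alpha\le1$, and let $\lambda_{(n)_i}>0$ ($n\ge n_0$, $1\le i\le k$). Let $\{\mathcal{X}(t)\}_{t\ge 0}$ and $\{\mathcal{X}^{\alpha}(t)\}_{t\ge0}$ be the generalized birth process and the generalized fractional birth process with these rates, and let $\{T_{2\alpha}(t)\}_{t>0}$ be a process, independent of $\{\mathcal{X}(t)\}$, whose one-dimensional distribution is the folded solution $f_{T_{2\alpha}}(x,t)$ of the fractional diffusion equation described in the context. Suppose that for every $m\ge1$ and every tuple $(x_1,\dots,x_m)\in\Theta_m^{k}$ the numbers $\mu_l=\sum_{i=1}^{k}\lambda_{(n_0+(j)_l)_i}$, $l=1,\dots,m^*$, where $m^*=|\Lambda_m|$, are distinct. Then for each $t>0$ $$\mathcal{X}^{\alpha}(t)\overset{d}{=}\mathcal{X}(T_{2\alpha}(t)),$$ where $\overset{d}{=}$ denotes equality in distribution.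
   Context: Caputo derivative: for $0<\alpha<1$, $\frac{\mathrm{d}^{\alpha}}{\mathrm{d}t^{\alpha}}f(t)=\frac{1}{\Gamma(1-\alpha)}\int_0^t(t-s)^{-\alpha}f'(s)\,\mathrm{d}s$; for $\alpha=1$ it is $f'(t)$ (and for orders in $(1,2]$ it is the usual Caputo derivative). The generalized fractional birth process (GFBP) $\{\mathcal{X}^{\alpha}(t)\}_{t\ge0}$ is the process whose state probabilities $p^{\alpha}(n,t)=\mathrm{Pr}\{\mathcal{X}^{\alpha}(t)=n\}$ satisfy $$\frac{\mathrm{d}^{\alpha}}{\mathrm{d}t^{\alpha}}p^{\alpha}(n,t)=-\sum_{i=1}^{k}\lambda_{(n)_i}p^{\alpha}(n,t)+\sum_{i=1}^{\min\{n,k\}}\lambda_{(n-i)_i}p^{\alpha}(n-i,t),\quad n\ge n_0,$$ with $p^{\alpha}(n_0,0)=1$, $p^{\alpha}(n,0)=0$ for $n>n_0$, and $p^{\alpha}(n,t)=0$ for $n<n_0$. The generalized birth process (GBP) $\{\mathcal{X}(t)\}_{t\ge0}$ is the case $\alpha=1$: it starts at $n_0$ and from state $n$ jumps to $n+i$, $1\le i\le k$, with rate $\lambda_{(n)_i}$; its state probabilities $p(n,t)=\mathrm{Pr}\{\mathcal{X}(t)=n\}$ satisfy $$\frac{\mathrm{d}}{\mathrm{d}t}p(n,t)=-\sum_{i=1}^{k}\lambda_{(n)_i}p(n,t)+\sum_{i=1}^{\min\{n,k\}}\lambda_{(n-i)_i}p(n-i,t),\quad n\ge n_0,$$ with $p(n_0,0)=1$,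 $p(n,0)=0$ for $n>n_0$, and $p(n,t)=0$ for $n<n_0$. The sets $\Theta_n^k\subset\mathbb{R}^n$ ($n,k\ge1$): let $\bar e_n^{\,j}$ be the $n$-tuple unit row vector with $1$ at the $j$th place and $0$ elsewhere, and for $m>n$ let $Q_{n\times m}=[\,I_{n\times n}\ \ O_{n\times(m-n)}\,]$ (identity block followed by zero block), so that $\bar x\mapsto\bar xQ_{n\times m}$ appends $m-n$ zeros to $\bar x$. For a set $A$ of row vectors, $AQ+v=\{\bar xQ+v:\bar x\in A\}$. Then $\Theta_1^k=\{(1)\}$ for all $k\ge1$, and for $n\ge2$ $$\Theta_n^k=\begin{cases}\bigcup_{i=1}^{k}\left\{\Theta_{n-i}^{k}Q_{(n-i)\times n}+i\,\bar e_n^{\,n-i+1}\right\}, & 1\le k\le n-1,\\[1ex]\bigcup_{i=1}^{n-1}\left\{\Theta_{n-i}^{n}Q_{(n-i)\times n}+i\,\bar e_n^{\,n-i+1}\right\}\cup\{n\,\bar e_n^{\,1}\}, & k\ge n.\end{cases}$$ For $(x_1,\dots,x_n)\in\Theta_n^k$, $\Lambda_n=\{0,1,\dots,n\}\setminus\{1\le j\le n-1:\ x_{j+1}=0\}$, $n^*=|\Lambda_n|$, and $(j)_1<(j)_2<\dots<(j)_{n^*}$ are the elements of $\Lambda_n$ in increasing order, i.e. $(j)_1=0$, $(j)_l=\inf\{(j)_{l-1}<j\le n-1:\ x_{j+1}\ne0\}$ for $1<l<n^*$, and $(j)_{n^*}=n$. All of these depend on the tuple. The process $T_{2\alpha}$: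 $f_{T_{2\alpha}}(x,t)$ is the folded solution (i.e. $2u(x,t)$ for $x>0$ and $0$ for $x<0$) of $$\frac{\mathrm{d}^{2\alpha}}{\mathrm{d}t^{2\alpha}}u(x,t)=\frac{\partial^2}{\partial x^2}u(x,t),\quad x\in\mathbb{R},\ t>0,$$ with $u(x,0)=\delta(x)$ for $0<\alpha\le1$ and $\frac{\partial}{\partial t}u(x,0)=0$ for $1/2<\alpha\le1$. It is known that $\int_0^{\infty}e^{-st}f_{T_{2\alpha}}(x,t)\,\mathrm{d}t=s^{\alpha-1}e^{-xs^{\alpha}}$ for $x>0$ (for $\alpha=1$ the density is understood in the generalized sense). *)

(* Defs.v *)
From HB Require Import structures.
From mathcomp Require Import all_boot all_order all_algebra.
From mathcomp Require Import all_classical all_reals all_analysis.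
Set Implicit Arguments.
Unset Strict Implicit.
Unset Printing Implicit Defensive.
Import Order.TTheory GRing.Theory Num.Theory.
Import numFieldNormedType.Exports.
Local Open Scope classical_set_scope.
Local Open Scope ring_scope.

(* State space of the counting processes: [Some n] is the state n and [None]
   the point at infinity.  No non-explosion condition is put on the rates, so
   the state probabilities may add up to less than 1; a process that takes
   only finite values is one that never visits [None]. *)
Definition state : Type := option nat.
HB.instance Definition _ := Pointed.on state.
HB.instance Definition _ := @isMeasurable.Build default_measure_display state
  (@discrete_measurable state) (@discrete_measurable0 state)
  (@discrete_measurableC state) (@discrete_measurableU state).

Section caputo.
Context {R : realType}.
Implicit Types (f : R -> R) (a b t : R).
Local Notation mu := (@lebesgue_measure R).

Definition Gamma a : R :=
  \int[mu]_(x in `]0, +oo[) (x `^ (a - 1) * expR (- x)).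

(* m - 1 < b <= m when 0 < b *)
Definition caputo_order b : nat := `|Num.ceil b|%N.

Definition caputo b f t : R :=
  let m := caputo_order b in
  if m%:R == b then derive1n m f t
  else (Gamma (m%:R - b))^-1 *
       \int[mu]_(s in `[0, t])
         ((t - s) `^ (m%:R - 1 - b) * derive1n m f s).

(* Since [derive1n] and the integral are total, this says that [caputo b f t]
   is meaningful at every t > 0.  The first part is the standard requirement
   that f, ..., f^(m-1) be locally absolutely continuous, with derivatives
   integrable up to 0. *)
Definition caputo_derivable b f : Prop :=
  let m := caputo_order b in
  (forall k : nat, (k < m)%N -> forall s t, 0 < s -> s <= t ->
     mu.-integrable `[0, t] (EFin \o derive1n k.+1 f) /\
     derive1n k f t - derive1n k f s =
       \int[mu]_(r in `[s, t]) derive1n k.+1 f r) /\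
  (forall t, 0 < t ->
     if m%:R == b then derivable (derive1n m.-1 f) t 1
     else mu.-integrable `[0, t]
            (EFin \o (fun s => (t - s) `^ (m%:R - 1 - b) * derive1n m f s))).

End caputo.

Section processes.
Context {R : realType} {d : measure_display} {Omega : measurableType d}.

Definition state_prob (P : probability Omega R) (X : R -> Omega -> state)
    (n : nat) (t : R) : R :=
  fine (P (X t @^-1` [set Some n])).

(* The limit at 0+ makes the initial values effective: the equations
   only concern t > 0. *)
Definition is_GFBP (k n0 : nat) (alpha : R) (lambda : nat -> nat -> R)
    (P : probability Omega R) (X : R -> Omega -> state) : Prop :=
  let p := state_prob P X in
  [/\ forall t, 0 <= t -> measurable_fun setT (X t),
      forall n t, (n < n0)%N -> 0 <= t -> p n t = 0,
      p n0 0 = 1 /\ (forall n, (n0 < n)%N -> p n 0 = 0) &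
      forall n, (n0 <= n)%N ->
        [/\ caputo_derivable alpha (p n),
            p n t @[t --> 0^'+] --> p n 0 &
            forall t, 0 < t ->
              caputo alpha (p n) t =
                - (\sum_(1 <= i < k.+1) lambda n i * p n t) +
                \sum_(1 <= i < (minn n k).+1)
                  lambda (n - i)%N i * p (n - i)%N t]].

(* As a jump process, it has right-continuous paths for the discrete topology
   on the states; without this X(T(t)) need not even be measurable. *)
Definition is_GBP (k n0 : nat) (lambda : nat -> nat -> R)
    (P : probability Omega R) (X : R -> Omega -> state) : Prop :=
  is_GFBP k n0 1 lambda P X /\
  (forall w t, 0 <= t -> \forall s \near t^'+, X s w = X t w).

Definition process_sigma {d' : measure_display} {S : measurableType d'}
    (D : set R) (X : R -> Omega -> S) : set (set Omega) :=
  <<s [set A | exists t (B : set S),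
         [/\ D t, measurable B & A = X t @^-1` B]] >>.

Definition independent_processes {d1 d2 : measure_display}
    {S1 : measurableType d1} {S2 : measurableType d2}
    (P : probability Omega R) (D1 : set R) (X1 : R -> Omega -> S1)
    (D2 : set R) (X2 : R -> Omega -> S2) : Prop :=
  forall A B, process_sigma D1 X1 A -> process_sigma D2 X2 B ->
    P (A `&` B) = (P A * P B)%E.

End processes.

Definition eq_in_distribution {R : realType} {d1 d2 d' : measure_display}
    {Omega1 : measurableType d1} {Omega2 : measurableType d2}
    {S : measurableType d'}
    (P1 : probability Omega1 R) (X1 : Omega1 -> S)
    (P2 : probability Omega2 R) (X2 : Omega2 -> S) : Prop :=
  [/\ measurable_fun setT X1, measurable_fun setT X2 &
      forall B : set S, measurable B -> P1 (X1 @^-1` B) = P2 (X2 @^-1` B)].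

Section diffusion.
Context {R : realType}.

Definition test_function (phi : R -> R) : Prop :=
  [/\ forall x, derivable phi x 1,
      forall x, derivable (derive1n 1 phi) x 1,
      continuous (derive1n 2 phi) &
      exists M : R, forall x, M < `|x| -> phi x = 0].

Definition pairing (u : R -> probability (measurableTypeR R) R)
    (phi : R -> R) (t : R) : R :=
  \int[u t]_x phi x.

(* Fundamental solution of d^{2 alpha} u / dt^{2 alpha} = d^2 u / dx^2 on
   R x (0, oo), with u(., t) read as a probability measure on R and the space
   derivatives moved to test functions.  This is needed not only at alpha = 1,
   where u(., t) is half the sum of the Dirac masses at t and - t:
   for alpha < 1, alpha <> 1/2, the solution has a kink at x = 0. *)
Definition fundamental_solution (alpha : R)
    (u : R -> probability (measurableTypeR R) R) : Prop :=
  forall phi, test_function phi ->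
    [/\ caputo_derivable (2 * alpha) (pairing u phi),
        forall t, 0 < t ->
          caputo (2 * alpha) (pairing u phi) t = pairing u (derive1n 2 phi) t,
        pairing u phi t @[t --> 0^'+] --> phi 0 &
        2^-1 < alpha -> derive1n 1 (pairing u phi) t @[t --> 0^'+] --> (0 : R)].

(* [f t] is the measure with density 2 u(x, t) on x > 0 and 0 on x < 0. *)
Definition folded_solution (alpha : R) (f : R -> set R -> \bar R) : Prop :=
  exists2 u, fundamental_solution alpha u &
    forall t, 0 < t -> forall A : set R, measurable A ->
      f t A = (2%:E * u t (A `&` `]0, +oo[)%R)%E.

End diffusion.

Section theta.
Context {R : realType}.

Definition unit_row (n j : nat) : 'rV[R]_n := \row_(l < n) (l.+1 == j)%:R.

(* [pid_mx n : 'M_(n, m)] is the block matrix Q_{n x m} = [I O] for n < m. *)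
Inductive Theta : nat -> forall n : nat, 'rV[R]_n -> Prop :=
| Theta_one k : (1 <= k)%N -> @Theta k 1 (unit_row 1 1)
| Theta_le k n i (x : 'rV[R]_(n - i)) :
    (2 <= n)%N -> (1 <= k <= n - 1)%N -> (1 <= i <= k)%N ->
    @Theta k (n - i) x ->
    @Theta k n (x *m (pid_mx (n - i) : 'M[R]_(n - i, n)) +
                i%:R *: unit_row n (n - i + 1))
| Theta_ge k n i (x : 'rV[R]_(n - i)) :
    (2 <= n)%N -> (n <= k)%N -> (1 <= i <= n - 1)%N ->
    @Theta n (n - i) x ->
    @Theta k n (x *m (pid_mx (n - i) : 'M[R]_(n - i, n)) +
                i%:R *: unit_row n (n - i + 1))
| Theta_top k n : (2 <= n)%N -> (n <= k)%N ->
    @Theta k n (n%:R *: unit_row n 1).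

(* Matrix columns are numbered from 0, so x_{j+1} is [x 0 j]. *)
Definition Lambda (n : nat) (x : 'rV[R]_n) : {set 'I_n.+1} :=
  (~: [set widen_ord (leqnSn n) j | j : 'I_n & (1 <= j)%N && (x 0 j == 0)])%SET.

(* The increasing sequence (j)_1, ..., (j)_{n^*}. *)
Definition Lambda_seq (n : nat) (x : 'rV[R]_n) : seq nat :=
  [seq nat_of_ord j | j <- enum (Lambda x)].

End theta.

(* Main.v *)
From HB Require Import structures.
Require Import Defs.
From mathcomp Require Import all_boot all_order all_algebra.
From mathcomp Require Import all_classical all_reals all_analysis.
From mathcomp Require Import measurable_realfun.
From mathcomp Require Import ring lra.
Import Order.TTheory GRing.Theory Num.Theory.
Import numFieldNormedType.Exports.
Set Implicit Arguments.
Unset Strict Implicit.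
Unset Printing Implicit Defensive.
Local Open Scope classical_set_scope.
Local Open Scope ring_scope.

(** Everything is done on the side of the Laplace transform in the time t,
    written L below.

    Transforms of the fractional process.  A function with a Caputo derivative
    of order b is recovered from that derivative by a fractional integration of
    order b, which is a convolution with r^(b-1) / Gamma(b); this is Abel's
    inversion, a Fubini argument based on the Beta integral for complementary
    exponents ([abel_inversion], [Caputo_Laplace]).  The forward equations thus
    become a linear recursion for the transforms of the state probabilities,
    in which s enters only through z = s^alpha and A = s^alpha / s
    ([GFBP_recursion]).  As the total rates mu_j are distinct, the recursion is
    solved by partial fractions, with coefficients c_j that do not depend on z
    and A ([birth_partial_fractions]):
      L p^alpha(n, .)(s) = sum_j c_j s^(alpha-1) / (s^alpha + mu_j).
    For alpha = 1 this is the transform of a sum of exponentials, whence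
      p(n, t) = sum_j c_j exp(- mu_j t)
    with the same coefficients ([GBP_mixture]).

    Transforms of the random time.  It remains to know the transform in t of
    E exp(- m T(t)), where T is the process T_{2 alpha}.  In the weak form of
    the diffusion equation, the fractional derivative of order 2 alpha
    turns into the factor s^(2 alpha) on test functions that vanish on the left
    half-line, where the initial value phi(0) contributes nothing.  Such test
    functions approximate the sums of exponentials vanishing to second order at
    0 ([Laplace_expsum]).  A sum of four exponentials, one exponent being
    s^alpha and another one tending to infinity, then gives
      L (E exp(- m T(.)))(s) = s^(alpha-1) / (s^alpha + m)
    for m different from s^alpha ([Laplace_expT]).

    Conclusion.  Since X is right-continuous and independent of T,
    P(X(T(t)) = n) = E p(n, T(t)) = sum_j c_j E exp(- mu_j T(t))
    ([prob_subordinated]).  By the two computations this function of t and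
    p^alpha(n, .) have the same transform at all large s; both are continuous
    and bounded on t > 0, so they are equal ([Laplace_unique]).  The laws agree
    on the finite states, hence also on the state at infinity. *)

(** * Reflection, translation and scaling of Lebesgue integrals *)

Section change_of_variables.
Context {R : realType}.
Local Notation mu := (@lebesgue_measure R).

(** A named map into [measurableTypeR R], so that pushing a measure forward
    along it yields a measure. *)
Definition reflect_at (t : R) : measurableTypeR R -> measurableTypeR R :=
  fun r => t - r.

Lemma measurable_reflect_at t : measurable_fun setT (reflect_at t).
Proof. by apply: measurable_funB => //; exact: measurable_id. Qed.

HB.instance Definition _ t := isMeasurableFun.Build _ _ _ _ (reflect_at t)
  (measurable_reflect_at t).

Lemma lebesgue_measure_reflect (t : R) (A : set R) : measurable A ->
  pushforward mu (reflect_at t) A = mu A.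
Proof.
move=> mA; apply/esym/lebesgue_measure_unique => //= _ [[a b]] _ <-.
rewrite /pushforward/= (_ : _ @^-1` _ = `[t - b, t - a[%classic).
  by rewrite !lebesgue_measure_itv/= !lte_fin ltrD2l ltrN2; case: ifPn => // _;
    rewrite -!EFinB; congr EFin; ring.
apply/seteqP; split => r /=; rewrite !in_itv/= /reflect_at; lra.
Qed.

Lemma ge0_integral_reflect (t : R) (f : R -> \bar R) :
  measurable_fun setT f -> (forall r, 0 <= f r)%E ->
  (\int[mu]_r f (t - r)%R = \int[mu]_r f r)%E.
Proof.
move=> mf f0.
rewrite [RHS](eq_measure_integral (pushforward mu (reflect_at t))).
  by rewrite ge0_integral_pushforward//= preimage_setT.
by move=> A mA _; exact/esym/lebesgue_measure_reflect.
Qed.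

Lemma ge0_integral_translate (t : R) (f : R -> \bar R) :
  measurable_fun setT f -> (forall r, 0 <= f r)%E ->
  (\int[mu]_r f (r - t)%R = \int[mu]_r f r)%E.
Proof.
move=> mf f0.
rewrite -[RHS](ge0_integral_reflect (- t))//.
rewrite -[RHS](ge0_integral_reflect 0)//.
  by apply: eq_integral => r _; congr f; ring.
by apply: measurableT_comp => //; apply: measurable_funB.
Qed.

Definition scale_by (c : R) : measurableTypeR R -> measurableTypeR R :=
  fun r => c * r.

Lemma measurable_scale_by c : measurable_fun setT (scale_by c).
Proof. by apply: measurable_funM => //; exact: measurable_id. Qed.

HB.instance Definition _ c := isMeasurableFun.Build _ _ _ _ (scale_by c)
  (measurable_scale_by c).

Definition scaled_measure (c : R) : {measure set (measurableTypeR R) -> \bar R} :=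
  measure_function_pushforward__canonical__measure_function_Measure mu
    (measurable_scale_by c).

Lemma lebesgue_measure_scale (c : {posnum R}) (A : set R) : measurable A ->
  mscale (c%:num%:nng) (scaled_measure c%:num) A = mu A.
Proof.
move=> mA; apply/esym/lebesgue_measure_unique => //= _ [[a b]] _ <-.
rewrite /mscale/= /pushforward/=.
rewrite (_ : _ @^-1` _ = `]c%:num^-1 * a, c%:num^-1 * b]%classic).
  rewrite !lebesgue_measure_itv/= !lte_fin ltr_pM2l ?invr_gt0//.
  case: ifPn => _; last by rewrite mule0.
  by rewrite -!EFinB -EFinM; congr EFin; rewrite -mulrBr mulVKf.
apply/seteqP; split => r /=; rewrite !in_itv/= /scale_by ltr_pdivrMl// ler_pdivlMl//.
Qed.

Lemma ge0_integral_scale (c : R) (f : R -> \bar R) : 0 < c ->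
  measurable_fun setT f -> (forall r, 0 <= f r)%E ->
  (c%:E * \int[mu]_r f (c * r)%R = \int[mu]_r f r)%E.
Proof.
move=> c0 mf f0.
rewrite [RHS](eq_measure_integral
   (mscale (PosNum c0)%:num%:nng (scaled_measure c))).
  rewrite ge0_integral_mscale//= ge0_integral_pushforward//= preimage_setT.
by move=> A mA _; exact/esym/(@lebesgue_measure_scale (PosNum c0)).
Qed.

End change_of_variables.

(** * The kernels of fractional integration *)

Section gamma_kernel.
Context {R : realType}.
Local Notation mu := (@lebesgue_measure R).
Implicit Types c s t x : R.

Local Notation gdens c := (fun x : R => x `^ (c - 1) * expR (- x)).

Lemma measurable_gamma_density c : measurable_fun setT (gdens c).
Proof.
apply: measurable_funM; first exact: measurable_powR.
by apply: measurableT_comp => //; exact: oppr_measurable.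
Qed.

(** The integrand is unbounded at 0 when c < 1, so the primitive x^c / c is used
    on [1/(n+1), 1] before letting n tend to infinity. *)
Lemma integral_powR_01 c : 0 < c ->
  (\int[mu]_(x in `]0%R, 1%R]) (x `^ (c - 1))%:E <= (c^-1)%:E)%E.
Proof.
move=> c0.
pose D (n : nat) : set R := `[n.+1%:R^-1, 1]%classic.
have -> : `]0, 1]%classic = \bigcup_n D n :> set R.
  apply/seteqP; split => [x /=|x [n _] /=]; rewrite ?/D/= !in_itv/=.
    move=> /andP[x0 x1].
    have [n nx] : exists n : nat, n.+1%:R^-1 <= x.
      exists (Num.truncn x^-1); rewrite invf_ple ?posrE//.
      by rewrite ltW// truncnS_gt.
    by exists n => //=; rewrite /D/= in_itv/= nx.
  by move=> /andP[nx ->]; rewrite andbT (lt_le_trans _ nx).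
have H : (\int[mu]_(x in D n) (x `^ (c - 1))%:E)%E
    @[n --> \oo] --> (\int[mu]_(x in \bigcup_n D n) (x `^ (c - 1))%:E)%E.
  apply: ge0_nondecreasing_set_cvg_integral => //.
  - move=> m n mn; apply/subsetPset => x; rewrite /D/= !in_itv/= => /andP[nx ->].
    by rewrite andbT (le_trans _ nx)// lef_pV2 ?posrE// ler_nat.
  - by move=> n; exact: measurable_itv.
  - by move=> n; apply/measurable_EFinP/measurable_funTS; exact: measurable_powR.
  - by move=> n x _; rewrite lee_fin powR_ge0.
rewrite -(cvg_lim _ H)//; apply: lime_le.
  by apply/cvg_ex; eexists; exact: H.
apply: nearW => n; rewrite /D.
case: n => [|n].
  rewrite invr1 set_itv1 integral_set1 lee_fin invr_ge0; exact: ltW.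
have n0 : 0 < n.+2%:R^-1 :> R by rewrite invr_gt0.
have n1 : n.+2%:R^-1 < 1 :> R by rewrite invf_lt1// ltr1n.
have dF (x : R) : 0 < x -> is_derive x 1 (fun x : R => c^-1 * x `^ c) (x `^ (c - 1)).
  move=> x0.
  have dx : derivable (fun x : R => x `^ c) x 1.
    by apply: derivable_powR; rewrite in_itv/= x0.
  apply: is_derive_eq; first exact: (@is_deriveZ R R R _ c^-1 x 1 _ (derivableP dx)).
  by rewrite -derive1E powR_derive1 ?in_itv/= ?x0// -[LHS]/(c^-1 * _) mulrA mulVf ?mul1r// gt_eqF.
have cF (x : R) : 0 < x -> {for x, continuous (fun x : R => c^-1 * x `^ c)}.
  move=> x0; apply: differentiable_continuous; apply/derivable1_diffP.
  exact: (@ex_derive _ _ _ _ _ _ _ (dF x x0)).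
rewrite (@continuous_FTC2 _ _ (fun x => c^-1 * x `^ c))//.
- by rewrite powR1 mulr1 -EFinB lee_fin lerBlDr lerDl mulr_ge0 ?powR_ge0// invr_ge0 ltW.
- apply: continuous_in_subspaceT => x; rewrite inE/= in_itv/= => /andP[xn _].
  have x0 : 0 < x by exact: lt_le_trans xn.
  apply: differentiable_continuous; apply/derivable1_diffP.
  by apply: derivable_powR; rewrite in_itv/= x0.
- split => [x|/=|/=].
  + rewrite in_itv/= => /andP[nx _].
    exact: (@ex_derive _ _ _ _ _ _ _ (dF x (lt_trans n0 nx))).
  + by apply/cvg_at_right_filter/cF.
  + by apply/cvg_at_left_filter/cF.
- move=> x; rewrite in_itv/= => /andP[nx _]; rewrite derive1E.
  exact: (@derive_val _ _ _ _ _ _ _ (dF x (lt_trans n0 nx))).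
Qed.

Lemma integral_expRN_pos :
  (\int[mu]_(x in `]0%R, +oo[) (expR (- x))%:E = 1)%E.
Proof.
have cexpN : continuous (fun x : R => expR (- x)).
  move=> x; apply: continuous_comp; last exact: continuous_expR.
  exact: (@continuousN _ R^o).
have mE : measurable_fun setT (fun x : R => expR (- x)).
  exact: continuous_measurable_fun.
rewrite integral_itv_obnd_cbnd//; last first.
  by apply/measurable_EFinP/measurable_funTS.
rewrite (@ge0_continuous_FTC2y _ _ (fun x => - expR (- x)) _ 0)//.
- by rewrite oppr0 expR0 EFinN oppeK add0e.
- by apply: continuous_subspaceT.
- by rewrite -oppr0; apply: cvgN; exact: cvgr_expR.
- by apply: cvgN; apply/cvg_at_right_filter; exact: cexpN.
- move=> x _; rewrite derive1E deriveN// -derive1E derive1_comp// derive1N// derive1_id derive1E.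
  by have /funeqP -> := @derive_expR R; rewrite mulrN1 opprK.
Qed.

(** Finiteness comes from comparing the integrand with x^(c-1) on ]0, 1] and,
    as c <= 1, with exp(-x) beyond 1; positivity from its values on ]0, 1]. *)
Lemma GammaE c : 0 < c <= 1 ->
  (0 < Gamma c) /\ ((Gamma c)%:E = \int[mu]_(x in `]0%R, +oo[) (gdens c x)%:E)%E.
Proof.
move=> /andP[c0 c1].
have mg := measurable_gamma_density c.
have g0 x : 0 <= gdens c x by rewrite mulr_ge0 ?powR_ge0 ?expR_ge0.
have fin : (\int[mu]_(x in `]0%R, +oo[) (gdens c x)%:E < +oo)%E.
  have -> : `]0, +oo[%classic = `]0, 1]%classic `|` `]1, +oo[%classic :> set R.
    by apply/seteqP; split => x /=; rewrite !in_itv/= !andbT; lra.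
  rewrite ge0_integral_setU//=; last 3 first.
  - by apply/measurable_EFinP/measurable_funTS.
  - by move=> x _; rewrite lee_fin.
  - apply/disj_setPS => x [] /=; rewrite !in_itv/=; lra.
  apply: lte_add_pinfty.
    apply: le_lt_trans (ltry (c^-1)).
    apply: le_trans (integral_powR_01 c0); apply: ge0_le_integral => //.
    - by move=> x _; rewrite lee_fin.
    - by apply/measurable_EFinP/measurable_funTS.
    - by apply/measurable_EFinP/measurable_funTS; exact: measurable_powR.
    - move=> x /=; rewrite in_itv/= lee_fin => /andP[x0 _].
      by rewrite ler_piMr ?powR_ge0// expR_le1 oppr_le0 ltW.
  apply: le_lt_trans (ltry 1); rewrite -integral_expRN_pos.
  have mE : measurable_fun setT (fun x : R => expR (- x)).
    by apply: measurableT_comp => //; exact: oppr_measurable.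
  apply: (@le_trans _ _ (\int[mu]_(x in `]1%R, +oo[) (expR (- x))%:E)%E).
    apply: ge0_le_integral => //.
    - by move=> x _; rewrite lee_fin.
    - by apply/measurable_EFinP/measurable_funTS.
    - by apply/measurable_EFinP/measurable_funTS.
    - move=> x /=; rewrite in_itv/= lee_fin andbT => x1.
      rewrite ler_piMl ?expR_ge0// -[leRHS](powRr0 x).
      by apply: ler_powR; [exact: ltW|rewrite subr_le0].
  apply: ge0_subset_integral => //.
  - by apply/measurable_EFinP/measurable_funTS.
  - by move=> x /=; rewrite !in_itv/= !andbT; lra.
have gE : ((Gamma c)%:E = \int[mu]_(x in `]0%R, +oo[) (gdens c x)%:E)%E.
  rewrite /Gamma /Rintegral fineK// ge0_fin_numE//.
  by apply: integral_ge0 => x _; rewrite lee_fin.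
split => //; rewrite -lte_fin gE.
apply: (@lt_le_trans _ _ (expR (- 1))%:E); first by rewrite lte_fin expR_gt0.
apply: (@le_trans _ _ (\int[mu]_(x in `]0%R, 1%R]) (gdens c x)%:E)%E).
  apply: (@le_trans _ _ (\int[mu]_(x in `]0%R, 1%R]) (cst (expR (- 1))%:E x))%E).
    by rewrite integral_cst//= lebesgue_measure_itv/= lte_fin ltr01 oppr0 adde0 mule1.
  apply: ge0_le_integral => //.
  - by move=> x _; rewrite lee_fin expR_ge0.
  - by apply/measurable_EFinP/measurable_funTS.
  - move=> x /=; rewrite in_itv/= lee_fin => /andP[x0 x1].
    rewrite -[leLHS]mul1r ler_pM ?ler01 ?expR_ge0//.
      by rewrite -[leLHS](powRr0 x) ger_powR ?x0//; lra.
    by rewrite ler_expR lerN2.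
apply: ge0_subset_integral => //.
- by apply/measurable_EFinP/measurable_funTS.
- by move=> x _; rewrite lee_fin.
- by move=> x /=; rewrite !in_itv/=; lra.
Qed.

(** The kernel of the Riemann-Liouville fractional integral of order c, extended
    by 0 so that convolutions on the half-line are convolutions on R. *)
Definition rl_kernel c : R -> R :=
  (fun r => (Gamma c)^-1 * r `^ (c - 1)) \_ `]0, +oo[.

Lemma measurable_rl_kernel c : measurable_fun setT (rl_kernel c).
Proof.
apply/measurable_restrict => //; apply/measurable_funTS.
by apply: measurable_funM => //; exact: measurable_powR.
Qed.

Lemma rl_kernel_pos c r : 0 < r -> rl_kernel c r = (Gamma c)^-1 * r `^ (c - 1).
Proof. by move=> r0; rewrite /rl_kernel patchE ifT// inE/= in_itv/= r0. Qed.

Lemma rl_kernel_npos c r : r <= 0 -> rl_kernel c r = 0.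
Proof.
by move=> r0; rewrite /rl_kernel patchE ifF//; apply/memNset; rewrite /= in_itv/= andbT => /(le_lt_trans r0); rewrite ltxx.
Qed.

Lemma rl_kernel_ge0 c r : 0 < c <= 1 -> 0 <= rl_kernel c r.
Proof.
move=> /GammaE[g0 _]; have [r0|r0] := ltP 0 r; last by rewrite rl_kernel_npos.
by rewrite rl_kernel_pos// mulr_ge0 ?powR_ge0// invr_ge0 ltW.
Qed.

Lemma rl_kernel_scale c t r : 0 < t -> rl_kernel c (t * r) = t `^ (c - 1) * rl_kernel c r.
Proof.
move=> t0; have [r0|r0] := ltP 0 r; last first.
  by rewrite !rl_kernel_npos ?mulr0// mulr_ge0_le0// ltW.
by rewrite !rl_kernel_pos// ?mulr_gt0// powRM ?ltW// mulrCA.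
Qed.

(** Scaling by s in the integral defining Gamma(c). *)
Lemma Laplace_rl_kernelE c s : 0 < c <= 1 -> 0 < s ->
  (\int[mu]_t (expR (- (s * t)) * rl_kernel c t)%:E = (s `^ (- c))%:E)%E.
Proof.
move=> c01 s0; have [g0 gE] := GammaE c01.
have mE : measurable_fun setT (fun x : R => expR (- x)).
  by apply: measurableT_comp => //; exact: oppr_measurable.
pose f (t : R) := expR (- t) * rl_kernel c t.
have f0 t : 0 <= f t by rewrite mulr_ge0 ?expR_ge0 ?rl_kernel_ge0.
have mf : measurable_fun setT f by apply: measurable_funM => //; exact: measurable_rl_kernel.
have If : (\int[mu]_t (f t)%:E = 1)%E.
  rewrite -[RHS]/(1%:E) -[X in X%:E](@mulVf _ (Gamma c)) ?gt_eqF//.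
  rewrite EFinM gE -ge0_integralZl//=; last 3 first.
  - by apply/measurable_EFinP/measurable_funTS; exact: (measurable_gamma_density c).
  - by move=> x _; rewrite lee_fin mulr_ge0// ?powR_ge0 ?expR_ge0.
  - by rewrite lee_fin invr_ge0 ltW.
  rewrite [RHS]integral_mkcond; apply: eq_integral => t _.
  rewrite patchE; case: ifPn => t0; last first.
    rewrite /f rl_kernel_npos ?mulr0//; apply: contraNT t0.
    by rewrite -ltNge inE/= in_itv/= => ->.
  move: t0; rewrite inE/= in_itv/= andbT => t0.
  by rewrite /f rl_kernel_pos// -EFinM; congr EFin; ring.
have := @ge0_integral_scale R s (EFin \o f) s0.
rewrite /= If => /(_ _ _)/=.
have -> : (\int[mu]_r (f (s * r)%R)%:E =
    (s `^ (c - 1))%:E * \int[mu]_t (expR (- (s * t)) * rl_kernel c t)%:E)%E.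
  rewrite -ge0_integralZl//=.
  - by apply: eq_integral => r _; rewrite /f rl_kernel_scale// -EFinM; congr EFin; ring.
  - apply/measurable_EFinP/measurable_funM; last exact: measurable_rl_kernel.
    apply: (measurableT_comp mE) => //.
  - by move=> x _; rewrite lee_fin mulr_ge0 ?expR_ge0 ?rl_kernel_ge0.
  - by rewrite lee_fin powR_ge0.
rewrite muleA -EFinM mulr_powRB1 ?ltW//; last by case/andP: c01.
have sc : 0 < s `^ c by rewrite powR_gt0.
move=> H.
have {}H : ((s `^ c)%:E * \int[mu]_t (expR (- (s * t)) * rl_kernel c t)%:E = 1)%E.
  apply: H => [|r]; last by rewrite lee_fin.
  exact/measurable_EFinP.
rewrite powRN; transitivity ((s `^ c)^-1%:E * 1)%E; last by rewrite mule1.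
by rewrite -H muleA -EFinM mulVf ?mul1e// gt_eqF.
Qed.

End gamma_kernel.

(** * Convolution on the half-line and the Laplace transform *)

Section convolution.
Context {R : realType}.
Local Notation mu := (@lebesgue_measure R).
Implicit Types (s t : R) (f u v w U V : R -> R).

Lemma integral_translate t (f : R -> \bar R) : measurable_fun setT f ->
  (\int[mu]_r f (r - t)%R = \int[mu]_r f r)%E.
Proof.
move=> mf; rewrite integralE [RHS]integralE (funepos_comp f (fun r => r - t)).
rewrite (funeneg_comp f (fun r => r - t)).
have mp := measurable_funepos mf; have mn := measurable_funeneg mf.
congr (_ - _)%E.
  by rewrite -[RHS](ge0_integral_translate t).
by rewrite -[RHS](ge0_integral_translate t).
Qed.

(** Fubini, together with the invariance of the measure under translations. *)
Lemma convolution_integrable U V :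
  mu.-integrable setT (EFin \o U) -> mu.-integrable setT (EFin \o V) ->
  (mu \x mu)%E.-integrable setT
     (fun z : R * R => (U (z.1 - z.2) * V z.2)%:E) /\
  (\int[mu]_t \int[mu]_r (U (t - r) * V r)%:E =
    (\int[mu]_t (U t)%:E) * (\int[mu]_t (V t)%:E))%E.
Proof.
move=> iU iV.
have mU : measurable_fun setT U by apply/measurable_EFinP; exact: measurable_int iU.
have mV : measurable_fun setT V by apply/measurable_EFinP; exact: measurable_int iV.
have mUV : measurable_fun setT (fun z : R * R => (U (z.1 - z.2) * V z.2)%:E).
  apply/measurable_EFinP/measurable_funM; last by apply: measurableT_comp.
  by apply: measurableT_comp => //; apply: measurable_funB.
have mUt r : measurable_fun setT (fun t : R => (U (t - r))%:E).
  by apply/measurable_EFinP; apply: measurableT_comp => //; apply: measurable_funB.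
have mUa r : measurable_fun setT (fun t : R => (`|U (t - r)|)%:E).
  apply/measurable_EFinP; apply: measurableT_comp => //.
  by apply: measurableT_comp => //; apply: measurable_funB.
have mUa0 : measurable_fun setT (fun t : R => (`|U t|)%:E).
  by apply/measurable_EFinP; apply: measurableT_comp.
have mVa0 : measurable_fun setT (fun t : R => (`|V t|)%:E).
  by apply/measurable_EFinP; apply: measurableT_comp.
have iUV : (mu \x mu)%E.-integrable setT
     (fun z : R * R => (U (z.1 - z.2) * V z.2)%:E).
  apply/integrable21ltyP => //=.
  apply: (@le_lt_trans _ _
    (\int[mu]_r ((\int[mu]_t (`|U t|)%:E) * (`|V r|)%:E))%E).
    rewrite le_eqVlt; apply/orP; left; apply/eqP.
    apply: eq_integral => r _; under eq_integral do rewrite normrM EFinM.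
    rewrite ge0_integralZr//; last exact: mUa.
    by rewrite (@ge0_integral_translate _ r (fun t => (`|U t|)%:E)).
  rewrite ge0_integralZl//; last exact: integral_ge0.
  apply: lte_mul_pinfty; first exact: integral_ge0.
  - rewrite ge0_fin_numE; last exact: integral_ge0.
    by case/integrableP: iU.
  - by case/integrableP: iV.
split => //.
rewrite (@Fubini _ _ _ _ _ mu mu (fun z : R * R => (U (z.1 - z.2) * V z.2)%:E))//=.
have UE : (\int[mu]_t (U t)%:E = (fine (\int[mu]_t (U t)%:E))%:E)%E.
  by rewrite fineK//; apply: integrable_fin_num.
rewrite UE -integralZl// -UE; apply: eq_integral => r _.
under eq_integral do rewrite EFinM.
rewrite integralZr//.
  by rewrite (@integral_translate r (EFin \o U))//; apply/measurable_EFinP.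
apply/integrableP; split => //=; first exact: mUt.
rewrite (@ge0_integral_translate _ r (fun t => (`|U t|)%:E))//.
by case/integrableP: iU.
Qed.

Definition Laplace_integrable s f :=
  mu.-integrable `]0, +oo[ (EFin \o (fun t => expR (- (s * t)) * f t)).

Definition Laplace s f : R :=
  \int[mu]_(t in `]0, +oo[) (expR (- (s * t)) * f t).

(** The equation is between extended reals: the integral being finite, it also
    says that the integrand is integrable on ]0, t[. *)
Definition is_conv u v w :=
  forall t, 0 < t ->
    ((w t)%:E = \int[mu]_(r in `]0%R, t[) (u (t - r)%R * v r)%:E)%E.

Lemma LaplaceE s f : Laplace_integrable s f ->
  ((Laplace s f)%:E = \int[mu]_(t in `]0%R, +oo[) (expR (- (s * t)) * f t)%:E)%E.
Proof.
by move=> h; rewrite /Laplace /Rintegral fineK//; apply: integrable_fin_num.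
Qed.

Lemma conv_restrict u v t :
  (\int[mu]_(r in `]0%R, t[) (u (t - r)%R * v r)%:E =
   \int[mu]_r ((u \_ `]0, +oo[) (t - r)%R * (v \_ `]0, +oo[) r)%:E)%E.
Proof.
rewrite integral_mkcond; apply: eq_integral => r _.
rewrite !patchE !mem_setE !in_itv/= !andbT subr_gt0.
by case: (0 < r); case: (r < t); rewrite /= /point/= ?mul0r ?mulr0.
Qed.

(** As exp(- s t) = exp(- s (t - r)) exp(- s r), multiplying by the exponential
    commutes with convolution, and Fubini applies to the functions so obtained. *)
Lemma Laplace_conv s u v w : Laplace_integrable s u -> Laplace_integrable s v -> is_conv u v w ->
  Laplace_integrable s w /\ Laplace s w = Laplace s u * Laplace s v.
Proof.
move=> iu iv cw.
pose e f : R -> R := (fun t => expR (- (s * t)) * f t).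
pose U := e u \_ `]0, +oo[; pose V := e v \_ `]0, +oo[.
have iU : mu.-integrable setT (EFin \o U).
  by rewrite /U -restrict_EFin; apply/(integrable_mkcond _ _).1.
have iV : mu.-integrable setT (EFin \o V).
  by rewrite /V -restrict_EFin; apply/(integrable_mkcond _ _).1.
have [iUV UV] := convolution_integrable iU iV.
have E t : (\int[mu]_r (U (t - r) * V r)%:E = ((e w \_ `]0, +oo[) t)%:E)%E.
  rewrite -conv_restrict patchE mem_setE in_itv/= andbT; case: ifPn => t0; last first.
    by rewrite set_itv_ge ?integral_set0.
  pose G r := U (t - r) * V r.
  have mU : measurable_fun setT U by apply/measurable_EFinP; exact: measurable_int iU.
  have mV : measurable_fun setT V by apply/measurable_EFinP; exact: measurable_int iV.
  have mG : measurable_fun setT G.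
    apply: measurable_funM => //.
    by apply: measurableT_comp => //; apply: measurable_funB.
  have wE : ((w t)%:E = \int[mu]_(r in `]0%R, t[) (expR (s * t) * G r)%:E)%E.
    rewrite cw//; apply: eq_integral => r; rewrite inE/= in_itv/= => /andP[r0 rt].
    rewrite /G /U /V !patchE !ifT; last 2 first.
      by rewrite inE/= in_itv/= r0.
      by rewrite inE/= in_itv/= andbT subr_gt0.
    congr EFin; rewrite /e (_ : s * t = s * (t - r) + s * r); last by ring.
    by rewrite expRD !expRN; field; rewrite !gt_eqF ?expR_gt0.
  have iG : mu.-integrable `]0, t[ (fun r => (expR (s * t) * G r)%:E).
    have mG' : measurable_fun `]0, t[ (fun r => (expR (s * t) * G r)%:E).
      by apply/measurable_EFinP/measurable_funTS; apply: measurable_funM.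
    have h : (\int[mu]_(r in `]0%R, t[) (expR (s * t) * G r)%:E)%E \is a fin_num.
      by rewrite -wE.
    by apply/integrableP; split => //; rewrite integral_fin_num_abs//; exact/measurable_EFinP.
  rewrite /e EFinM wE -integralZl//.
  apply: eq_integral => r; rewrite inE/= in_itv/= => /andP[r0 rt].
  rewrite /G /U /V !patchE !mem_setE !in_itv/= !andbT subr_gt0 rt r0 -EFinM.
  by congr EFin; rewrite [RHS]mulrA -expRD addNr expR0 mul1r.
have iw : Laplace_integrable s w.
  apply/(integrable_mkcond _ _).2 => //.
  have := integrable_fubini_F iUV; apply: eq_integrable => // t _.
  by rewrite /fubini_F/= E restrict_EFin.
split => //; apply: EFin_inj; rewrite EFinM !LaplaceE//.
rewrite integral_mkcond restrict_EFin [X in (_ = X * _)%E]integral_mkcond restrict_EFin.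
rewrite [X in (_ = _ * X)%E]integral_mkcond restrict_EFin -UV.
by apply: eq_integral => t _; rewrite E.
Qed.

End convolution.

(** * Abel's integral equation *)

Section abel.
Context {R : realType}.
Local Notation mu := (@lebesgue_measure R).
Implicit Types (a c s t : R) (f g h : R -> R).

Lemma measurable_expRNM s : measurable_fun setT (fun t : R => expR (- (s * t))).
Proof.
apply: measurableT_comp => //; apply: measurableT_comp; first exact: oppr_measurable.
exact: mulrl_measurable.
Qed.

Lemma Laplace_rl_kernel c s : 0 < c <= 1 -> 0 < s ->
  Laplace_integrable s (rl_kernel c) /\ Laplace s (rl_kernel c) = s `^ (- c).
Proof.
move=> c01 s0; have LE := Laplace_rl_kernelE c01 s0.
have mk : measurable_fun setT (fun t : R => expR (- (s * t)) * rl_kernel c t).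
  by apply: measurable_funM; [exact: measurable_expRNM|exact: measurable_rl_kernel].
have k0 t : 0 <= expR (- (s * t)) * rl_kernel c t by rewrite mulr_ge0 ?expR_ge0 ?rl_kernel_ge0.
have LE' : (\int[mu]_(t in `]0%R, +oo[) (expR (- (s * t)) * rl_kernel c t)%:E = (s `^ (- c))%:E)%E.
  rewrite -LE integral_mkcond; apply: eq_integral => t _.
  rewrite patchE mem_setE in_itv/= andbT; case: ltP => // t0.
  by rewrite rl_kernel_npos ?mulr0.
have LK : Laplace_integrable s (rl_kernel c).
  apply/integrableP; split; first by apply/measurable_EFinP/measurable_funTS.
  rewrite /=; under eq_integral do rewrite ger0_norm//.
  by rewrite LE' ltry.
by split => //; apply: EFin_inj; rewrite LaplaceE.
Qed.

Lemma Gamma1 : Gamma (1 : R) = 1.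
Proof.
have h : 0 < (1 : R) <= 1 by rewrite ltr01 lexx.
have [_] := GammaE h.
under eq_integral do rewrite subrr powRr0 mul1r.
by rewrite integral_expRN_pos => -[].
Qed.

Lemma rl_kernel1 t : 0 < t -> rl_kernel 1 t = 1.
Proof. by move=> t0; rewrite rl_kernel_pos// Gamma1 invr1 mul1r subrr powRr0. Qed.

(** The Beta integral for complementary exponents: scaling shows that the
    convolution of the two kernels is constant on the half-line, and its
    Laplace transform at 1 identifies the constant. *)
Lemma rl_kernel_conv a t : 0 < a < 1 -> 0 < t ->
  (\int[mu]_r (rl_kernel (1 - a) (t - r) * rl_kernel a r)%:E = 1)%E.
Proof.
move=> /andP[a0 a1].
have ca : 0 < a <= 1 by rewrite a0 ltW.
have cb : 0 < 1 - a <= 1 by rewrite subr_gt0 a1 gerBl ltW.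
pose B := (\int[mu]_r (rl_kernel (1 - a) (1 - r) * rl_kernel a r)%:E)%E.
have mk (c : R) (T : R) : measurable_fun setT (fun r : R => rl_kernel c (T - r)).
  apply: measurableT_comp; first exact: measurable_rl_kernel.
  exact: measurable_funB.
have mkk (T : R) : measurable_fun setT (fun r : R => (rl_kernel (1 - a) (T - r) * rl_kernel a r)%:E).
  by apply/measurable_EFinP/measurable_funM => //; exact: measurable_rl_kernel.
have kk0 (T r : R) : 0 <= rl_kernel (1 - a) (T - r) * rl_kernel a r.
  by rewrite mulr_ge0 ?rl_kernel_ge0.
have BE (T : R) : 0 < T -> (\int[mu]_r (rl_kernel (1 - a) (T - r) * rl_kernel a r)%:E = B)%E.
  move=> T0; rewrite -(ge0_integral_scale T0) => [|//|r]; last by rewrite lee_fin.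
  rewrite -ge0_integralZl//=; last 3 first.
  - apply/measurable_EFinP; apply: measurable_funM.
      apply: measurableT_comp; first exact: measurable_rl_kernel.
      by apply: measurable_funB => //; exact: mulrl_measurable.
    apply: measurableT_comp; first exact: measurable_rl_kernel.
    exact: mulrl_measurable.
  - by move=> r _; rewrite lee_fin.
  - by rewrite lee_fin ltW.
  apply: eq_integral => r _; rewrite -EFinM; congr EFin.
  rewrite (_ : T - T * r = T * (1 - r)); last by ring.
  rewrite !rl_kernel_scale// mulrACA -powRD; last by apply/implyP => _; rewrite gt_eqF.
  rewrite (_ : 1 - a - 1 + (a - 1) = -1); last by ring.
  by rewrite powR_inv1 ?ltW// mulVKf// gt_eqF.
move=> t0; rewrite BE//.
have eK (c : R) : 0 < c <= 1 ->
    mu.-integrable setT (fun r : R => (expR (- r) * rl_kernel c r)%:E) /\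
    (\int[mu]_r (expR (- r) * rl_kernel c r)%:E = 1)%E.
  move=> c01; have [iK _] := Laplace_rl_kernel c01 (@ltr01 R).
  have := Laplace_rl_kernelE c01 (@ltr01 R); rewrite powR1.
  under eq_integral do rewrite mul1r; move=> ->; split => //.
  move/(integrable_mkcond _ _).1 : iK => /(_ (measurable_itv _)).
  apply: eq_integrable => // r _; rewrite patchE mem_setE in_itv/= andbT.
  by case: ltP => r0; rewrite ?mul1r// rl_kernel_npos// mulr0.
have [ia Ia] := eK _ ca; have [ib Ib] := eK _ cb.
have e1 : 0 < (1 : R) <= 1 by rewrite ltr01 lexx.
have [_ I1] := eK _ e1.
have [_] := convolution_integrable ib ia.
rewrite Ia Ib mule1 => <-.
rewrite -[LHS]mul1e -I1 -ge0_integralZr//; last 3 first.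
- apply/measurable_EFinP; apply: measurable_funM; last exact: measurable_rl_kernel.
  by apply: measurableT_comp => //; exact: oppr_measurable.
- by move=> r _; rewrite lee_fin mulr_ge0 ?expR_ge0 ?rl_kernel_ge0.
- by apply: integral_ge0 => r _; rewrite lee_fin.
apply: eq_integral => T _; have [T0|T0] := ltP 0 T; last first.
  rewrite [rl_kernel 1 T]rl_kernel_npos// mulr0 mul0e integral0_eq// => r _.
  have [r0|r0] := ltP 0 r; last by rewrite [rl_kernel a r]rl_kernel_npos// !mulr0.
  by rewrite rl_kernel_npos ?mulr0 ?mul0r// subr_le0 (le_trans T0)// ltW.
rewrite rl_kernel1// mulr1 -(BE T)// -ge0_integralZl//; last 2 first.
- exact: mkk.
- by move=> r _; rewrite lee_fin.
apply: eq_integral => r _; rewrite -EFinM; congr EFin.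
rewrite (_ : - T = - (T - r) + - r); last by ring.
by rewrite expRD; ring.
Qed.

(** The function h is the fractional integral of order a of F.  Integrating it
    again, to the order 1 - a, and exchanging the two integrations brings in the
    convolution of the two kernels, which is 1 by [rl_kernel_conv]; what is left is
    the primitive of F.  The exchange also shows that h is measurable: up to an
    explicit factor it is a partial integral of an integrable function. *)
Lemma abel_inversion a (F h : R -> R) : 0 < a < 1 ->
  (forall t, 0 < t -> mu.-integrable `[0, t] (EFin \o F)) ->
  (forall t, 0 < t -> mu.-integrable `[0, t]
     (EFin \o (fun s => (t - s) `^ (a - 1) * F s))) ->
  (forall t, 0 < t ->
     h t = (Gamma a)^-1 * \int[mu]_(s in `[0, t]) ((t - s) `^ (a - 1) * F s)) ->
  measurable_fun (`]0, +oo[%classic : set R) h /\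
  is_conv (rl_kernel (1 - a)) h (fun t => \int[mu]_(s in `[0, t]) F s).
Proof.
move=> a01 iF ikF hE; have /andP[a0 a1] := a01.
have ca : 0 < a <= 1 by rewrite a0 ltW.
have cb : 0 < 1 - a <= 1 by rewrite subr_gt0 a1 gerBl ltW.
have [Ga _] := GammaE ca.
have mk (c : R) (T : R) : measurable_fun setT (fun r : R => rl_kernel c (T - r)).
  apply: measurableT_comp; first exact: measurable_rl_kernel.
  exact: measurable_funB.
have mk' (c : R) (T : R) : measurable_fun setT (fun r : R => rl_kernel c (r - T)).
  apply: measurableT_comp; first exact: measurable_rl_kernel.
  exact: measurable_funB.
pose before (T s : R) : R := (s < T)%R%:R.
have kk (T s : R) : (\int[mu]_t (rl_kernel (1 - a) (T - t) * rl_kernel a (t - s))%:E =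
    (before T s)%:E)%E.
  pose G (r : R) := (rl_kernel (1 - a) ((T - s) - r) * rl_kernel a r)%:E.
  transitivity (\int[mu]_t G (t - s)%R)%E.
    by apply: eq_integral => t _; rewrite /G; congr ((rl_kernel _ _ * _)%:E); ring.
  rewrite ge0_integral_translate; last 2 first.
  - by apply/measurable_EFinP/measurable_funM; [exact: mk|exact: measurable_rl_kernel].
  - by move=> r; rewrite lee_fin mulr_ge0 ?rl_kernel_ge0.
  rewrite /before; have [sT|sT] := ltP s T; first by rewrite rl_kernel_conv// subr_gt0.
  rewrite integral0_eq// => r _; rewrite /G.
  have [r0|r0] := ltP 0 r; last by rewrite [rl_kernel a r]rl_kernel_npos// mulr0.
  by rewrite rl_kernel_npos ?mul0r//; lra.
(* The integrand of the double integral, in t and s.  Integrated first in t it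
   gives the primitive of F, by kk, and integrated first in s the convolution
   of the kernel with h. *)
have key (T : R) : 0 < T ->
    let v := F \_ `[0, T] in
    let H := (fun z : R * R => (rl_kernel (1 - a) (T - z.1) * (rl_kernel a (z.1 - z.2) * v z.2))%:E) in
    [/\ (mu \x mu)%E.-integrable setT H,
     (\int[mu]_t \int[mu]_s H (t, s) = \int[mu]_s (v s * before T s)%:E)%E &
     forall t, (\int[mu]_s H (t, s) =
       (((fun t => rl_kernel (1 - a) (T - t) * h t) \_ `]0, T[) t)%:E)%E].
  move=> T0 v H.
  have iv : mu.-integrable setT (EFin \o v).
    by rewrite /v -restrict_EFin; apply/(integrable_mkcond _ _).1 => //; exact: iF.
  have mv : measurable_fun setT v by apply/measurable_EFinP; exact: measurable_int iv.
  have mH : measurable_fun setT H.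
    apply/measurable_EFinP; apply: measurable_funM.
      exact: (measurableT_comp (mk (1 - a) T)).
    apply: measurable_funM; last exact: measurableT_comp.
    by apply: (measurableT_comp (measurable_rl_kernel a)); apply: measurable_funB.
  have iH : (mu \x mu)%E.-integrable setT H.
    apply/integrable21ltyP => //.
    apply: (@le_lt_trans _ _ (\int[mu]_s (`|v s|)%:E)%E); last by case/integrableP: iv.
    apply: ge0_le_integral => //.
    - by move=> s _; apply: integral_ge0.
    - have mG := @measurable_fun_fubini_tonelli_G _ _ _ _ R mu (fun z => `|H z|)%E.
      by apply: mG => //; exact: measurableT_comp.
    - by apply/measurable_EFinP; apply: measurableT_comp.
    - move=> s _; rewrite /H /=.
      under eq_integral do rewrite mulrA normrM EFinM ger0_norm ?mulr_ge0 ?rl_kernel_ge0//.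
      rewrite ge0_integralZr//; last 2 first.
      + by apply/measurable_EFinP/measurable_funM; [exact: mk|exact: mk'].
      + by move=> t _; rewrite lee_fin mulr_ge0 ?rl_kernel_ge0.
      rewrite kk /before; case: (s < T); rewrite ?mul1e ?mul0e ?lee_fin//.
  split => //.
    rewrite (@Fubini _ _ _ _ _ mu mu H)//; apply: eq_integral => s _.
    rewrite /H/=; under eq_integral do rewrite mulrA mulrC EFinM.
    rewrite integralZl// ?kk//.
    apply/integrableP; split.
      by apply/measurable_EFinP/measurable_funM; [exact: mk|exact: mk'].
    under eq_integral do rewrite /= ger0_norm ?mulr_ge0 ?rl_kernel_ge0//.
    by rewrite kk ltry.
  move=> t; rewrite /H/= patchE mem_setE in_itv/=.
  have [Tt|tT] := leP T t.
    rewrite andbF integral0_eq// => s _; rewrite rl_kernel_npos ?mul0r//; lra.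
  have [t0|t0] := leP t 0.
    rewrite integral0_eq// => s _; rewrite /v patchE mem_setE in_itv/=.
    case: ifPn => [/andP[s0 _]|_]; last by rewrite !mulr0.
    rewrite [rl_kernel a _]rl_kernel_npos ?mul0r ?mulr0//; lra.
  rewrite /= hE//.
  have iK := ikF t t0.
  pose K (s : R) := (t - s) `^ (a - 1) * F s; pose c := rl_kernel (1 - a) (T - t) * (Gamma a)^-1.
  transitivity (\int[mu]_s (c%:E * (((EFin \o K) \_ `[0%R, t]) s)))%E.
    apply: eq_integral => s _; rewrite /c /v !patchE !mem_setE !in_itv/=.
    have [s0|s0] := leP 0 s; last by rewrite /= !mulr0 mule0.
    have [st|st] := leP s t; last by rewrite /= (@rl_kernel_npos _ a) ?mul0r ?mulr0 ?mule0//; lra.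
    rewrite (le_trans st (ltW tT))/= -EFinM; congr EFin.
    move: st; rewrite le_eqVlt => /predU1P[->|st].
      rewrite (@rl_kernel_npos _ a)// ?subrr// mul0r mulr0.
      by rewrite /K subrr powR0 ?mul0r ?mulr0// subr_eq0 lt_eqF.
    by rewrite (rl_kernel_pos a) ?subr_gt0// /K; ring.
  rewrite integralZl//; last exact/(integrable_mkcond _ _).1.
  rewrite -integral_mkcond mulrA [RHS]EFinM; congr (_ * _)%E.
  by rewrite /Rintegral fineK//; apply: integrable_fin_num.
split.
  have -> : `]0, +oo[%classic = \bigcup_n (`]0, n.+1%:R[%classic : set R).
    apply/seteqP; split => [x|x [n _]] /=; rewrite !in_itv/= ?andbT => x0.
      by exists (Num.truncn x) => //=; rewrite in_itv/= x0 truncnS_gt.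
    by case/andP: x0.
  apply/measurable_fun_bigcup => n; first exact: measurable_itv.
  have T0 : 0 < n.+1%:R :> R by [].
  have [iH _ FE] := key _ T0.
  have [Gb _] := GammaE cb.
  apply: (@eq_measurable_fun _ _ _ _ _ (fun t =>
    fine (\int[mu]_s (rl_kernel (1 - a) (n.+1%:R - t) * (rl_kernel a (t - s) * (F \_ `[0, n.+1%:R]) s))%:E)%E *
    (Gamma (1 - a) * (n.+1%:R - t) `^ a))).
    move=> t; rewrite inE/= in_itv/= => /andP[t0 tn].
    rewrite [X in fine X](FE t) patchE mem_setE in_itv/= t0 tn/= rl_kernel_pos ?subr_gt0//.
    rewrite (_ : 1 - a - 1 = - a); last by ring.
    rewrite powRN; field.
    by rewrite !gt_eqF// powR_gt0 ?subr_gt0.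
  apply: measurable_funTS; apply: measurable_funM.
    apply: measurableT_comp => //; exact: (measurable_fubini_F iH).
  apply: measurable_funM => //.
  apply: (measurableT_comp (measurable_powR _)).
  exact: measurable_funB.
move=> T T0; have [iH EH FE] := key _ T0.
have iFT := iF T T0.
transitivity (\int[mu]_s ((F \_ `[0, T]) s * before T s)%:E)%E.
  rewrite /Rintegral fineK; last by apply: integrable_fin_num.
  rewrite -integral_itv_bndo_bndc; last first.
    apply: measurable_funS (measurable_int _ iFT) => //.
    by move=> x /=; rewrite !in_itv/= => /andP[-> /ltW].
  rewrite integral_mkcond; apply: eq_integral => s _.
  rewrite /before !patchE !mem_setE !in_itv/=.
  have [s0|s0] := leP 0 s; last by rewrite /= mul0r.
  have [sT|sT] := ltP s T; last by rewrite /= mulr0.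
  by rewrite /= mulr1 ltW.
rewrite -EH [RHS]integral_mkcond; apply: eq_integral => t _.
by rewrite [LHS]FE !patchE; case: ifPn.
Qed.
End abel.

(** * The Laplace transform of a Caputo derivative *)

Section caputo_laplace.
Context {R : realType}.
Local Notation mu := (@lebesgue_measure R).
Implicit Types (a b c s t : R) (f g h F : R -> R).

Lemma Laplace_integrable_eq s f g : (forall t, 0 < t -> f t = g t) -> Laplace_integrable s f -> Laplace_integrable s g.
Proof.
move=> fg; apply: eq_integrable => // t; rewrite inE/= in_itv/= andbT => t0.
by rewrite fg.
Qed.

Lemma Laplace_eq s f g : (forall t, 0 < t -> f t = g t) -> Laplace s f = Laplace s g.
Proof.
move=> fg; apply: eq_Rintegral => t; rewrite inE/= in_itv/= andbT => t0.
by rewrite fg.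
Qed.

Lemma Laplace_integrable_D s f g : Laplace_integrable s f -> Laplace_integrable s g -> Laplace_integrable s (f \+ g).
Proof.
rewrite /Laplace_integrable => fi gi; have := integrableD _ fi gi => /(_ (measurable_itv _)).
by apply: eq_integrable => // t _; rewrite /= mulrDr EFinD.
Qed.

Lemma LaplaceD s f g : Laplace_integrable s f -> Laplace_integrable s g -> Laplace s (f \+ g) = Laplace s f + Laplace s g.
Proof.
move=> fi gi; rewrite /Laplace -RintegralD//.
by apply: eq_Rintegral => t _; rewrite /= mulrDr.
Qed.

Lemma Laplace_integrable_Z s c f : Laplace_integrable s f -> Laplace_integrable s (fun t => c * f t).
Proof.
rewrite /Laplace_integrable => i; have := integrableZl _ c i => /(_ (measurable_itv _)).
by apply: eq_integrable => // t _; rewrite /= -EFinM mulrCA.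
Qed.

Lemma LaplaceZ s c f : Laplace_integrable s f -> Laplace s (fun t => c * f t) = c * Laplace s f.
Proof.
move=> fi; rewrite /Laplace -RintegralZl//.
by apply: eq_Rintegral => t _; rewrite /= mulrCA.
Qed.

Lemma Laplace_integrable_cst s c : 0 < s -> Laplace_integrable s (fun=> c) /\ Laplace s (fun=> c) = c / s.
Proof.
move=> s0; have h : 0 < (1 : R) <= 1 by rewrite ltr01 lexx.
have [i1 L1] := Laplace_rl_kernel h s0.
have E t : 0 < t -> c * rl_kernel 1 t = c by move=> t0; rewrite rl_kernel1// mulr1.
split; first exact: (Laplace_integrable_eq E (Laplace_integrable_Z c i1)).
by rewrite -(Laplace_eq s E) LaplaceZ// L1 powR_inv1// ltW.
Qed.

Lemma Laplace_integrable_0 s : Laplace_integrable s (fun=> 0).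
Proof.
have := @integrable0 _ _ R mu `]0, +oo[%classic.
by apply: eq_integrable => // t _; rewrite /= mulr0.
Qed.

Lemma Laplace_0 s : Laplace s (fun=> 0 : R) = 0.
Proof. by rewrite /Laplace; under eq_Rintegral do rewrite mulr0; rewrite Rintegral_cst// mul0r. Qed.

Lemma Laplace_integrable_sum s (I : Type) (r : seq I) (P : pred I) (F : I -> R -> R) :
  (forall i, P i -> Laplace_integrable s (F i)) ->
  Laplace_integrable s (fun t => \sum_(i <- r | P i) F i t) /\
  Laplace s (fun t => \sum_(i <- r | P i) F i t) = \sum_(i <- r | P i) Laplace s (F i).
Proof.
move=> Fi; elim: r => [|i r [IHi IHL]].
  split; last by rewrite big_nil -[RHS](Laplace_0 s); apply: Laplace_eq => t _; rewrite big_nil.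
  by apply: Laplace_integrable_eq (Laplace_integrable_0 s) => t _; rewrite big_nil.
have [Pi|Pi] := boolP (P i); last first.
  split; first by apply: Laplace_integrable_eq IHi => t _; rewrite big_cons (negbTE Pi).
  by rewrite big_cons (negbTE Pi) -IHL; apply: Laplace_eq => t _; rewrite big_cons (negbTE Pi).
split; first by apply: Laplace_integrable_eq (Laplace_integrable_D (Fi i Pi) IHi) => t _; rewrite big_cons Pi.
rewrite big_cons Pi -IHL -LaplaceD//; last exact: Fi.
by apply: Laplace_eq => t _; rewrite big_cons Pi.
Qed.

Lemma Laplace_integrable_bounded s f (M : R) : 0 < s ->
  measurable_fun (`]0, +oo[%classic : set R) f ->
  (forall t, 0 < t -> `|f t| <= M) -> Laplace_integrable s f.
Proof.
move=> s0 mf fM; have [iM _] := Laplace_integrable_cst M s0.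
apply: (le_integrable _ _ _ iM) => //.
  apply/measurable_EFinP/measurable_funM => //.
  by apply: measurable_funTS; exact: measurable_expRNM.
move=> t /=; rewrite in_itv/= andbT => t0; rewrite lee_fin !normrM.
by rewrite ler_wpM2l// (le_trans (fM _ t0))// ler_norm.
Qed.

Lemma caputo_order1 b : 0 < b <= 1 -> caputo_order b = 1%N.
Proof.
by move=> b01; rewrite /caputo_order (@ceil_def _ _ 1).
Qed.

Lemma caputo_order2 b : 1 < b <= 2 -> caputo_order b = 2%N.
Proof.
by move=> b01; rewrite /caputo_order (@ceil_def _ _ 2).
Qed.

(** The Caputo derivative of order b is the fractional integral of order m - b
    of the m-th derivative, or this derivative itself if b = m, when the kernel
    that undoes this integral is the constant 1. *)
Lemma caputo_primitive b f : 0 < b <= 2 -> caputo_derivable b f ->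
  let m := caputo_order b in
  measurable_fun (`]0, +oo[%classic : set R) (caputo b f) /\
  is_conv (rl_kernel (1 - (m%:R - b))) (caputo b f)
    (fun t => \int[mu]_(s in `[0, t]) derive1n m f s).
Proof.
move=> b02 [dk dm] m.
have [bm mb] : b <= m%:R /\ m%:R - 1 < b.
  rewrite /m; have [b1|b1] := leP b 1.
    by rewrite caputo_order1; lra.
  by rewrite caputo_order2; lra.
have m0 : (0 < m)%N.
  rewrite /m; have [b1|b1] := leP b 1.
    by rewrite caputo_order1//; lra.
  by rewrite caputo_order2//; lra.
have iF t : 0 < t -> mu.-integrable `[0, t] (EFin \o derive1n m f).
  move=> t0; have h : (m.-1 < m)%N by rewrite prednK.
  by have [+ _] := dk _ h t t t0 (lexx t); rewrite prednK.
have [mbE|mbE] := eqVneq (m%:R : R) b.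
  have gE t : caputo b f t = derive1n m f t.
    by rewrite /caputo -/m mbE eqxx.
  rewrite (_ : caputo b f = derive1n m f); last exact/funext.
  split.
    have -> : `]0, +oo[%classic = \bigcup_n (`]0, n.+1%:R[%classic : set R).
      apply/seteqP; split => [x|x [n _]] /=; rewrite !in_itv/= ?andbT => x0.
        by exists (Num.truncn x) => //=; rewrite in_itv/= x0 truncnS_gt.
      by case/andP: x0.
    apply/measurable_fun_bigcup => n; first exact: measurable_itv.
    have /measurable_int/measurable_EFinP := iF n.+1%:R (ltr0Sn _ _).
    apply: measurable_funS => // x /=; rewrite !in_itv/= => /andP[x0 xn].
    by rewrite !ltW.
  move=> t t0; rewrite mbE subrr subr0.
  have it := iF t t0.
  rewrite /Rintegral fineK; last by apply: integrable_fin_num.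
  rewrite -integral_itv_bndo_bndc; last first.
    apply: measurable_funS (measurable_int _ it) => //.
    by move=> x /=; rewrite !in_itv/= => /andP[-> /ltW].
  rewrite -integral_itv_obnd_cbnd; last first.
    apply: measurable_funS (measurable_int _ it) => //.
    by move=> x /=; rewrite !in_itv/= => /andP[/ltW -> /ltW].
  apply: eq_integral => r; rewrite inE/= in_itv/= => /andP[r0 rt].
  by rewrite rl_kernel1 ?subr_gt0// mul1r.
have ab : 0 < m%:R - b < 1.
  by rewrite subr_gt0 lt_neqAle eq_sym mbE bm/=; lra.
apply: (abel_inversion ab) => //.
  move=> t t0; have := dm t t0; rewrite -/m (negbTE mbE).
  apply: eq_integrable => // s _ /=; congr ((_ `^ _ * _)%:E); ring.
move=> t t0; rewrite /caputo -/m (negbTE mbE); congr (_ * _).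
by apply: eq_Rintegral => s _; congr (_ `^ _ * _); ring.
Qed.

(** The increments on [s, t] being known, let s tend to 0. *)
Lemma primitive_from_0 f F (l : R) :
  (forall s t, 0 < s -> s <= t -> mu.-integrable `[0, t] (EFin \o F) /\
     f t - f s = \int[mu]_(r in `[s, t]) F r) ->
  f t @[t --> 0^'+] --> l ->
  forall t, 0 < t -> f t - l = \int[mu]_(r in `[0, t]) F r.
Proof.
move=> H fl t t0.
have [it _] := H t t t0 (lexx t).
have ct := parameterized_integral_continuous (ltW t0) it.
have [_ c0 _] := (continuous_within_itvP _ t0).1 ct.
have E s : 0 < s < t ->
    f t - \int[mu]_(r in `[0, t]) F r + \int[mu]_(r in `[0, s]) F r = f s.
  move=> /andP[s0 st]; have [_ fs] := H s t s0 (ltW st).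
  have := @Rintegral_itvB R F (BLeft 0) (BRight t) s it.
  rewrite !bnd_simp => /(_ (ltW s0) (ltW st)).
  rewrite Rintegral_itv_obnd_cbnd; last first.
    apply: integrableS it => //.
    by move=> x /=; rewrite !in_itv/= => /andP[sx ->]; rewrite (le_trans (ltW s0) (ltW sx)).
  by rewrite -fs; lra.
have lim0 : f s @[s --> 0^'+] --> f t - \int[mu]_(r in `[0, t]) F r.
  have h0 : \int[mu]_(r in `[0, s]) F r @[s --> 0^'+] --> (0 : R).
    by move: c0; rewrite /parameterized_integral set_itv1 Rintegral_set1.
  have h : f t - \int[mu]_(r in `[0, t]) F r + \int[mu]_(r in `[0, s]) F r
      @[s --> 0^'+] --> f t - \int[mu]_(r in `[0, t]) F r + 0.
    by apply: cvgD h0; exact: cvg_cst.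
  rewrite addr0 in h.
  apply: cvg_trans h; apply: near_eq_cvg; near=> s.
  by rewrite E//; apply/andP; split; near: s; [exact: nbhs_right_gt|exact: nbhs_right_lt].
have -> : l = f t - \int[mu]_(r in `[0, t]) F r.
  by apply: cvg_unique fl lim0; exact: Rhausdorff.
by ring.
Unshelve. all: by end_near. Qed.

Lemma primitive_continuous f F (l : R) :
  (forall t, 0 < t -> mu.-integrable `[0, t] (EFin \o F)) ->
  (forall t, 0 < t -> f t - l = \int[mu]_(r in `[0, t]) F r) ->
  forall t, 0 < t -> {for t, continuous f}.
Proof.
move=> iF fF t t0; pose T := t + 1.
have T0 : 0 < T by rewrite addr_gt0.
have ct := parameterized_integral_continuous (ltW T0) (iF T T0).
have [ci _ _] := (continuous_within_itvP _ T0).1 ct.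
have tT : t \in `]0, T[ by rewrite in_itv/= t0 ltrDl ltr01.
have h : l + \int[mu]_(r in `[0, s]) F r @[s --> t] --> l + \int[mu]_(r in `[0, t]) F r.
  by apply: cvgD; [exact: cvg_cst|exact: ci].
have E s : 0 < s -> l + \int[mu]_(r in `[0, s]) F r = f s.
  by move=> s0; rewrite -fF//; ring.
rewrite E// in h; rewrite /continuous_at.
apply: cvg_trans h; apply: near_eq_cvg; near=> s.
by rewrite E//; near: s; exact: lt_nbhsr.
Unshelve. all: by end_near. Qed.

(** The bound on the Caputo derivative g makes its transform exist; f is rebuilt
    from g by one (if b <= 1) or two convolutions, which carry
    the existence of the transform along to f. *)
Lemma Caputo_Laplace b f (f0 M s : R) : 0 < b <= 2 -> 0 < s ->
  caputo_derivable b f -> f t @[t --> 0^'+] --> f0 ->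
  (1 < b -> derive1n 1 f t @[t --> 0^'+] --> (0 : R)) ->
  (forall t, 0 < t -> `|caputo b f t| <= M) ->
  Laplace_integrable s f /\ Laplace s f = f0 / s + s `^ (- b) * Laplace s (caputo b f).
Proof.
move=> b02 s0 db ff0 df0 gM; have [mg cg] := caputo_primitive b02 db.
have [dk _] := db.
have ig : Laplace_integrable s (caputo b f) by exact: Laplace_integrable_bounded mg gM.
have e1 : 0 < (1 : R) <= 1 by rewrite ltr01 lexx.
have [i1 L1] := Laplace_rl_kernel e1 s0.
have [ic Lc] := Laplace_integrable_cst f0 s0.
have [b1|b1] := leP b 1.
  have m1 : caputo_order b = 1%N by apply: caputo_order1; lra.
  move: cg dk; rewrite m1 => cg dk.
  have bE : 1 - (1%:R - b) = b by ring.
  rewrite bE in cg.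
  have cb : 0 < b <= 1 by lra.
  have [ik Lk] := Laplace_rl_kernel cb s0.
  have [iw Lw] := Laplace_conv ik ig cg.
  have E t : 0 < t -> f0 + \int[mu]_(r in `[0, t]) derive1n 1 f r = f t.
    by move=> t0; rewrite -(primitive_from_0 (dk 0%N isT) ff0)//; rewrite /=; ring.
  split; first exact: (Laplace_integrable_eq E (Laplace_integrable_D ic iw)).
  by rewrite -(Laplace_eq s E) LaplaceD// Lc Lw Lk.
have m2 : caputo_order b = 2%N by apply: caputo_order2; lra.
move: cg dk; rewrite m2 => cg dk.
have cb : 0 < 1 - (2%:R - b) <= 1 by lra.
have [ik Lk] := Laplace_rl_kernel cb s0.
have [iw Lw] := Laplace_conv ik ig cg.
have E t : 0 < t -> \int[mu]_(r in `[0, t]) derive1n 2 f r = derive1n 1 f t.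
  by move=> t0; rewrite -(primitive_from_0 (dk 1%N isT) (df0 b1))//; rewrite /= subr0.
have iw1 := Laplace_integrable_eq E iw.
have Lw1 : Laplace s (derive1n 1 f) = s `^ (- (1 - (2%:R - b))) * Laplace s (caputo b f).
  by rewrite -(Laplace_eq s E) Lw Lk.
have c1 : is_conv (rl_kernel 1) (derive1n 1 f) (fun t => \int[mu]_(r in `[0, t]) derive1n 1 f r).
  move=> t t0; have [it _] := dk 0%N isT t t t0 (lexx t).
  rewrite /Rintegral fineK; last by apply: integrable_fin_num.
  rewrite -integral_itv_bndo_bndc; last first.
    apply: measurable_funS (measurable_int _ it) => //.
    by move=> x /=; rewrite !in_itv/= => /andP[-> /ltW].
  rewrite -integral_itv_obnd_cbnd; last first.
    apply: measurable_funS (measurable_int _ it) => //.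
    by move=> x /=; rewrite !in_itv/= => /andP[/ltW -> /ltW].
  apply: eq_integral => r; rewrite inE/= in_itv/= => /andP[r0 rt].
  by rewrite rl_kernel1 ?subr_gt0// mul1r.
have [iv Lv] := Laplace_conv i1 iw1 c1.
have E0 t : 0 < t -> f0 + \int[mu]_(r in `[0, t]) derive1n 1 f r = f t.
  by move=> t0; rewrite -(primitive_from_0 (dk 0%N isT) ff0)//; rewrite /=; ring.
split; first exact: (Laplace_integrable_eq E0 (Laplace_integrable_D ic iv)).
rewrite -(Laplace_eq s E0) LaplaceD// Lc Lv L1 Lw1 mulrA -powRD; last first.
  by apply/implyP => _; rewrite gt_eqF.
by congr (_ + _ `^ _ * _); ring.
Qed.

End caputo_laplace.

(** * Uniqueness of the Laplace transform *)

Section laplace_uniqueness.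
Context {R : realType}.
Local Notation mu := (@lebesgue_measure R).
Implicit Types (s t : R) (F f g : R -> R).

Lemma Laplace_le s f g : Laplace_integrable s f -> Laplace_integrable s g -> (forall t, 0 < t -> f t <= g t) ->
  Laplace s f <= Laplace s g.
Proof.
move=> fi gi fg; apply: le_Rintegral => // t; rewrite /= in_itv/= andbT => t0.
by rewrite ler_wpM2l ?expR_ge0// fg.
Qed.

Lemma bernoulli_le (q : R) n : 0 <= q -> 1 + n%:R * q <= (1 + q) ^+ n.
Proof.
move=> q0; elim: n => [|n IHn]; first by rewrite mul0r addr0 expr0.
rewrite exprS (le_trans _ (ler_wpM2l _ IHn)) ?addr_ge0// -natr1.
have : 0 <= n%:R * q * q by rewrite !mulr_ge0.
lra.
Qed.

(** Vanishing of the transform at the points s0 + i says that F is orthogonal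
    to all polynomials in exp(-t). *)
Lemma Laplace_horner_eq0 F (M s0 : R) (P : {poly R}) : 0 < s0 ->
  measurable_fun (`]0, +oo[%classic : set R) F ->
  (forall t, 0 < t -> `|F t| <= M) ->
  (forall s, s0 <= s -> Laplace s F = 0) ->
  Laplace_integrable s0 (fun t => P.[expR (- t)] * F t) /\
  Laplace s0 (fun t => P.[expR (- t)] * F t) = 0.
Proof.
move=> s00 mF FM F0.
pose G (i : 'I_(size P)) t := P`_i * (expR (- t) ^+ i * F t).
have E t : 0 < t -> \sum_(i < size P) G i t = P.[expR (- t)] * F t.
  by move=> t0; rewrite horner_coef mulr_suml; apply: eq_bigr => i _; rewrite /G mulrA.
have mE (i : nat) : measurable_fun setT (fun t : R => expR (- t) ^+ i).
  by apply: measurable_funX; apply: measurableT_comp => //; exact: oppr_measurable.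
have iG (i : nat) : Laplace_integrable s0 (fun t => expR (- t) ^+ i * F t).
  apply: (@Laplace_integrable_bounded _ _ _ M) => //.
    by apply: measurable_funM => //; apply: measurable_funTS.
  move=> t t0; rewrite normrM -[leRHS]mul1r ler_pM// ?FM//.
  by rewrite ger0_norm ?exprn_ge0 ?expR_ge0// exprn_ile1 ?expR_ge0// expR_le1 oppr_le0 ltW.
have [iS LS] := @Laplace_integrable_sum R s0 _ (index_enum _) xpredT G (fun i _ => Laplace_integrable_Z P`_i (iG i)).
split; first exact: Laplace_integrable_eq E iS.
rewrite -(Laplace_eq s0 E) LS big1// => i _.
rewrite LaplaceZ; last exact: iG.
rewrite [X in _ * X](_ : _ = 0) ?mulr0//.
transitivity (Laplace (s0 + i%:R) F); last by rewrite F0 ?lerDl.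
apply: eq_Rintegral => t _; rewrite mulrA; congr (_ * _).
by rewrite -expRM_natl -expRD; congr expR; rewrite -mulr_natl; ring.
Qed.

Lemma continuous_measurable_pos F : (forall t, 0 < t -> {for t, continuous F}) ->
  measurable_fun (`]0, +oo[%classic : set R) F.
Proof.
move=> cF; apply: open_continuous_measurable_fun; first exact: interval_open.
by move=> t; rewrite inE/= in_itv/= andbT => t0; exact: cF.
Qed.

(** Suppose that F > c > 0 near t0.  For D small, the polynomial
    p = 1 + D^2 - (y - exp(- t0))^2 in y = exp(- t) takes values in [0, 1] where
    F is not known to exceed c, and exceeds 1 + q on a smaller neighbourhood of
    t0.  The integral of p^n F against exp(- s0 t) is therefore at least
    (1 + q)^n c kappa - M / s0, although it vanishes for all n. *)
Lemma Laplace_unique0 F (M s0 : R) : 0 < s0 ->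
  (forall t, 0 < t -> {for t, continuous F}) ->
  (forall t, 0 < t -> `|F t| <= M) ->
  (forall s, s0 <= s -> Laplace s F = 0) ->
  forall t0, 0 < t0 -> F t0 <= 0.
Proof.
move=> s00 cF FM F0 t0 t00; rewrite leNgt; apply/negP => Ft0.
have mF := continuous_measurable_pos cF.
pose c := F t0 / 2.
have c0 : 0 < c by rewrite /c divr_gt0.
have [d /= d0 dF] : exists2 d : R, 0 < d & forall t, `|t0 - t| < d -> c < F t.
  have : \forall t \near t0, c < F t.
    by apply: (cvgr_gt (F t0) (cF _ t00)); rewrite /c; lra.
  by move=> /nbhs_ballP[d d0 h]; exists d => // t td; exact: h.
pose x0 := expR (- t0).
pose D := Num.min (x0 - expR (- (t0 + d))) (expR (- (t0 - d)) - x0).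
have D0 : 0 < D.
  by rewrite lt_min !subr_gt0 !ltr_expR; apply/andP; split; lra.
have out t : d <= `|t0 - t| -> D <= `|expR (- t) - x0|.
  rewrite ler_normr => /orP[h|h].
    rewrite ler_normr; apply/orP; left; rewrite ge_min; apply/orP; right.
    by rewrite lerD2r ler_expR; lra.
  rewrite ler_normr; apply/orP; right; rewrite ge_min; apply/orP; left.
  by rewrite opprB lerD2l lerN2 ler_expR; lra.
have [e /= e0 eD] : exists2 e : R, 0 < e & forall t, `|t0 - t| < e -> `|expR (- t) - x0| < D / 2.
  have cE : {for t0, continuous (fun t : R => expR (- t))}.
    by apply: continuous_comp; [exact: (@continuousN _ R^o)|exact: continuous_expR].
  have : \forall t \near t0, `|x0 - expR (- t)| < D / 2.
    by move/cvgrPdist_lt : cE; apply; rewrite divr_gt0.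
  by move=> /nbhs_ballP[e e0 h]; exists e => // t td; rewrite distrC; exact: h.
pose eta := Num.min (Num.min d e) t0.
have eta0 : 0 < eta by rewrite !lt_min d0 e0 t00.
pose I : set R := `]t0 - eta, t0 + eta[%classic.
pose q := 3 / 4 * D ^+ 2.
have q0 : 0 < q by rewrite mulr_gt0// ?exprn_gt0//; lra.
pose p : {poly R} := (1 + D ^+ 2)%:P - ('X - x0%:P) ^+ 2.
have pE t : p.[expR (- t)] = 1 + D ^+ 2 - `|expR (- t) - x0| ^+ 2.
  by rewrite /p !hornerE real_normK ?num_real.
have x01 : 0 < x0 < 1 by rewrite expR_gt0 expR_lt1; lra.
have p0 t : 0 < t -> 0 <= p.[expR (- t)].
  move=> tp; rewrite pE; have /andP[y0 y1] : 0 < expR (- t) < 1.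
    by rewrite expR_gt0 expR_lt1; lra.
  have : `|expR (- t) - x0| ^+ 2 <= 1.
    by rewrite expr_le1// ler_norml; lra.
  have := sqr_ge0 D; lra.
pose kappa := Laplace s0 (\1_I : R -> R).
have mI : measurable_fun setT (\1_I : R -> R) by apply: measurable_indic; exact: measurable_itv.
have iI : Laplace_integrable s0 (\1_I : R -> R).
  apply: (@Laplace_integrable_bounded _ _ _ 1) => //; first exact: measurable_funTS.
  by move=> t _; rewrite indicE; case: (_ \in _); rewrite /= ?normr1 ?normr0.
have k0 : 0 < kappa.
  rewrite -lte_fin /kappa LaplaceE//.
  pose k1 := expR (- (s0 * (t0 + eta))).
  apply: (@lt_le_trans _ _ (\int[mu]_(t in `]0%R, +oo[) (k1%:E * (\1_I t)%:E))%E).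
    rewrite ge0_integralZl//; last 2 first.
    - by apply/measurable_EFinP/measurable_funTS.
    - by rewrite lee_fin expR_ge0.
    rewrite integral_indic//; last exact: measurable_itv.
    rewrite (_ : I `&` _ = I); last first.
      apply/setIidPl => t; rewrite /I /= !in_itv/= andbT => /andP[h _].
      by apply: le_lt_trans h; rewrite subr_ge0 ge_min lexx orbT.
    rewrite /= /I lebesgue_measure_itv/= lte_fin ifT; last by lra.
    by rewrite -EFinB -EFinM lte_fin mulr_gt0 ?expR_gt0//; lra.
  apply: ge0_le_integral => //.
  - by move=> t _; rewrite -EFinM lee_fin mulr_ge0 ?expR_ge0.
  - by apply/measurable_EFinP/measurable_funTS; exact: measurable_funM.
  - apply/measurable_EFinP/measurable_funTS; apply: measurable_funM => //.
    exact: measurable_expRNM.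
  - move=> t _; rewrite -EFinM lee_fin indicE; have [tI|_] := boolP (t \in I).
      move: tI; rewrite inE /I/= in_itv/= => /andP[_ h].
      by rewrite !mulr1 /k1 ler_expR lerN2 ler_wpM2l// ltW.
    by rewrite !mulr0.
have M0 : 0 <= M by apply: le_trans (FM _ t00).
have main n : (1 + q) ^+ n * c * kappa <= M / s0.
  have [iP LP] := Laplace_horner_eq0 (p ^+ n) s00 mF FM F0.
  have [iM LM] := Laplace_integrable_cst (- M) s00.
  have ig := Laplace_integrable_D (Laplace_integrable_Z ((1 + q) ^+ n * c) iI) iM.
  rewrite -subr_le0 -mulNr -LM -LaplaceZ// -LaplaceD//; last exact: Laplace_integrable_Z.
  rewrite -[leRHS]LP; apply: Laplace_le => // t tp.
  rewrite /= horner_exp indicE; have pt := p0 t tp.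
  have [td|td] := ltP `|t0 - t| d.
    have Ft := dF t td.
    have [tI|_] := boolP (t \in I); last first.
      rewrite mulr0 add0r (@le_trans _ _ 0) ?oppr_le0// mulr_ge0 ?exprn_ge0//.
      by rewrite ltW// (lt_trans c0).
    rewrite mulr1 (@le_trans _ _ ((1 + q) ^+ n * c)) ?gerDl ?oppr_le0//.
    have te : `|t0 - t| < e.
      move: tI; rewrite inE /I/= in_itv/= => tI.
      have /andP[h _] : (eta <= e) && (eta <= d).
        by rewrite /eta !ge_min !lexx !orbT.
      by rewrite ltr_norml; lra.
    have q1 : 1 + q <= p.[expR (- t)].
      rewrite pE /q; have := eD t te => h.
      have : `|expR (- t) - x0| ^+ 2 <= (D / 2) ^+ 2.
        by rewrite lerXn2r ?nnegrE// ltW//; lra.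
      rewrite exprMn; lra.
    by rewrite ler_pM ?exprn_ge0 ?(ltW c0)// ?(ltW Ft)// ?addr_ge0 ?(ltW q0)// lerXn2r// nnegrE ?addr_ge0// ltW.
  rewrite memNset ?mulr0 ?add0r; last first.
    rewrite /I/= in_itv/= => h; move: td; apply/negP; rewrite -ltNge.
    have h2 : eta <= d by rewrite /eta !ge_min !lexx.
    by rewrite ltr_norml; lra.
  rewrite lerNl -mulrN; apply: le_trans (ler_norm _) _.
  rewrite normrM normrN -[leRHS]mul1r ler_pM ?FM//.
  rewrite ger0_norm ?exprn_ge0// exprn_ile1// pE.
  have : D ^+ 2 <= `|expR (- t) - x0| ^+ 2 by rewrite lerXn2r ?nnegrE ?(ltW D0)// out.
  lra.
have := main (Num.truncn (M / s0 / (q * c * kappa))).+1.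
set n := _.+1; apply/negP; rewrite -ltNge.
apply: (@lt_le_trans _ _ ((n%:R * q) * c * kappa)).
  rewrite (_ : n%:R * q * c * kappa = n%:R * (q * c * kappa)); last by ring.
  rewrite -ltr_pdivrMr ?mulr_gt0//.
  exact: truncnS_gt.
rewrite !ler_wpM2r ?(ltW k0) ?(ltW c0)//.
by rewrite (le_trans _ (bernoulli_le _ _)) ?(ltW q0)// lerDr.
Qed.

Lemma Laplace_unique f g (M N s0 : R) : 0 < s0 ->
  (forall t, 0 < t -> {for t, continuous f}) ->
  (forall t, 0 < t -> {for t, continuous g}) ->
  (forall t, 0 < t -> `|f t| <= M) -> (forall t, 0 < t -> `|g t| <= N) ->
  (forall s, s0 <= s -> Laplace s f = Laplace s g) ->
  forall t, 0 < t -> f t = g t.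
Proof.
move=> s00 cf cg fM gN fg.
have half f1 g1 (M1 N1 : R) :
    (forall t, 0 < t -> {for t, continuous f1}) ->
    (forall t, 0 < t -> {for t, continuous g1}) ->
    (forall t, 0 < t -> `|f1 t| <= M1) -> (forall t, 0 < t -> `|g1 t| <= N1) ->
    (forall s, s0 <= s -> Laplace s f1 = Laplace s g1) ->
    forall t, 0 < t -> f1 t <= g1 t.
  move=> cf1 cg1 fM1 gN1 fg1 t t0.
  rewrite -subr_le0.
  apply: (@Laplace_unique0 (fun t => f1 t - g1 t) (M1 + N1) s0) => //.
  - by move=> u u0; apply: continuousB; [exact: cf1|exact: cg1].
  - by move=> u u0; rewrite (le_trans (ler_normB _ _))// lerD ?fM1 ?gN1.
  - move=> s ss; have sp : 0 < s by exact: lt_le_trans ss.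
    have if1 := Laplace_integrable_bounded sp (continuous_measurable_pos cf1) fM1.
    have ig1 := Laplace_integrable_bounded sp (continuous_measurable_pos cg1) gN1.
    rewrite (@Laplace_eq _ s _ (f1 \+ (fun t => -1 * g1 t))) => [|u _]; last by rewrite /= mulN1r.
    rewrite LaplaceD//; last exact: Laplace_integrable_Z.
    by rewrite LaplaceZ// fg1// mulN1r subrr.
move=> t t0; apply/eqP; rewrite eq_le.
by rewrite (half f g M N)// (half g f N M)// => s ss; rewrite fg.
Qed.
End laplace_uniqueness.

(** * Test functions supported on the half-line *)

Section gluing.
Context {R : realType}.
Implicit Types (a b f g : R -> R) (c d x : R).

Lemma restrict_itvE b c d x :
  (b \_ `]c, d[) x = if c < x < d then b x else 0.
Proof. by rewrite patchE mem_setE in_itv. Qed.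

(** At the two ends both b and b1 vanish, so the difference quotient of the
    truncated function is dominated by that of b, which tends to 0. *)
Lemma restrict_is_derive b b1 c d :
  (forall x, is_derive x 1 b (b1 x)) ->
  b c = 0 -> b d = 0 -> b1 c = 0 -> b1 d = 0 ->
  forall x, is_derive x 1 (b \_ `]c, d[) ((b1 \_ `]c, d[) x).
Proof.
move=> db bc bd b1c b1d x; rewrite restrict_itvE.
have bnd : b x = 0 -> b1 x = 0 -> is_derive x 1 (b \_ `]c, d[) 0.
  move=> bx b1x; have [dbx eb] := db x.
  have H : h^-1 *: ((b \o shift x) (h *: 1) - b x) @[h --> 0^'] --> (0 : R).
    have : h^-1 *: ((b \o shift x) (h *: 1) - b x) @[h --> 0^'] --> 'D_1 b x by exact: dbx.
    by rewrite eb b1x.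
  have G : h^-1 *: (((b \_ `]c, d[) \o shift x) (h *: 1) - (b \_ `]c, d[) x)
      @[h --> 0^'] --> (0 : R).
    apply/cvgrPdist_le => e e0; move/cvgrPdist_le : H => /(_ e e0).
    apply: filterS => h; apply: le_trans.
    rewrite !sub0r !normrN /= !restrict_itvE bx.
    have -> : (if c < x < d then 0 else 0) = 0 :> R by case: ifP.
    rewrite !subr0 -[_ *: _]/(_ * _) -[X in _ <= `|X|]/(_ * _) !normrM.
    by rewrite ler_wpM2l//; case: ifP => // _; rewrite normr0.
  apply: DeriveDef; first by apply/cvg_ex; exists 0; exact: G.
  exact: cvg_lim G.
have [cxd|] := boolP (c < x < d).
  have /andP[cx xd] := cxd.
  apply: near_eq_is_derive (db x); near=> y.
  rewrite restrict_itvE ifT//; apply/andP; split; near: y.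
    exact: lt_nbhsr.
  exact: lt_nbhsl.
rewrite negb_and -!leNgt => /orP[].
  rewrite le_eqVlt => /predU1P[xc|xc]; first by apply: bnd; rewrite xc.
  apply: near_eq_is_derive (is_derive_cst (0 : R) x 1).
  near=> y; rewrite restrict_itvE; case: ifPn => // /andP[cy _].
  suff : y < c by rewrite ltNge (ltW cy).
  by near: y; exact: lt_nbhsl.
rewrite le_eqVlt => /predU1P[dx|dx]; first by apply: bnd; rewrite -dx.
apply: near_eq_is_derive (is_derive_cst (0 : R) x 1).
near=> y; rewrite restrict_itvE; case: ifPn => // /andP[_ yd].
suff : d < y by rewrite ltNge (ltW yd).
by near: y; exact: lt_nbhsr.
Unshelve. all: by end_near. Qed.

Lemma restrict_continuous b c d : continuous b -> b c = 0 -> b d = 0 ->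
  continuous (b \_ `]c, d[).
Proof.
move=> cb bc bd x.
have bnd : b x = 0 -> {for x, continuous (b \_ `]c, d[)}.
  move=> bx; apply/cvgrPdist_le => e e0; move: (cb x) => /cvgrPdist_le/(_ e e0).
  apply: filterS => y; apply: le_trans; rewrite !restrict_itvE bx.
  have -> : (if c < x < d then 0 else 0) = 0 :> R by case: ifP.
  by case: ifP => // _; rewrite subrr normr0.
have [cxd|] := boolP (c < x < d).
  have /andP[cx xd] := cxd.
  have := cb x; rewrite /continuous_at restrict_itvE cxd; apply: cvg_trans.
  apply: near_eq_cvg; near=> y.
  rewrite restrict_itvE ifT//; apply/andP; split; near: y.
    exact: lt_nbhsr.
  exact: lt_nbhsl.
rewrite negb_and -!leNgt => /orP[].
  rewrite le_eqVlt => /predU1P[xc|xc]; first by apply: bnd; rewrite xc.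
  rewrite /continuous_at restrict_itvE ifF; last by apply/negP => /andP[]; lra.
  apply: cvg_near_cst; near=> y; rewrite restrict_itvE; case: ifPn => // /andP[cy _].
  suff : y < c by rewrite ltNge (ltW cy).
  by near: y; exact: lt_nbhsl.
rewrite le_eqVlt => /predU1P[dx|dx]; first by apply: bnd; rewrite -dx.
rewrite /continuous_at restrict_itvE ifF; last by apply/negP => /andP[]; lra.
apply: cvg_near_cst; near=> y; rewrite restrict_itvE; case: ifPn => // /andP[_ yd].
suff : d < y by rewrite ltNge (ltW yd).
by near: y; exact: lt_nbhsr.
Unshelve. all: by end_near. Qed.

(** The cube keeps the product of class C^2 at N, where it is glued to 0; the next
    two functions are its derivatives. *)
Definition cutoff (N : R) a : R -> R :=
  (fun x => a x * (1 - x / N) ^+ 3) \_ `]0, N[.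

Definition cutoff1 (N : R) a a1 : R -> R :=
  (fun x => a1 x * (1 - x / N) ^+ 3 - 3 / N * a x * (1 - x / N) ^+ 2) \_ `]0, N[.

Definition cutoff2 (N : R) a a1 a2 : R -> R :=
  (fun x => a2 x * (1 - x / N) ^+ 3 - 6 / N * a1 x * (1 - x / N) ^+ 2
     + 6 / N ^+ 2 * a x * (1 - x / N)) \_ `]0, N[.

Lemma is_derive_ramp (N : R) x : is_derive x 1 (fun x => 1 - x / N) (- N^-1).
Proof.
have h := is_deriveB (is_derive_cst (1 : R) x (1 : R))
  (is_deriveM (is_derive_id x (1 : R)) (is_derive_cst (N^-1) x (1 : R))).
apply: (is_derive_eq h); rewrite /= scaler0 !add0r.
by rewrite -[_ *: _]/(_ * _) mulr1.
Qed.

Variables (N : R) (a a1 a2 : R -> R).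
Hypothesis N0 : 0 < N.
Hypothesis da : forall x, is_derive x 1 a (a1 x).
Hypothesis da1 : forall x, is_derive x 1 a1 (a2 x).
Hypothesis ca2 : continuous a2.
Hypothesis (a_0 : a 0 = 0) (a1_0 : a1 0 = 0) (a2_0 : a2 0 = 0).

Let scaleR_mul (u v : R) : u *: v = u * v. Proof. by []. Qed.

Let qN : 1 - N / N = 0. Proof. by rewrite mulfV ?subrr// gt_eqF. Qed.

Lemma is_derive_cutoff x : is_derive x 1 (cutoff N a) (cutoff1 N a a1 x).
Proof.
apply: restrict_is_derive => [{}x||||].
- have dq := is_derive_ramp N x.
  apply: (is_derive_eq (is_deriveM (da x) (is_deriveX 3 dq))).
  have -> : ((fun y : R => 1 - y / N) ^+ 3) x = (1 - x / N) ^+ 3 by [].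
  by rewrite /= !scaleR_mul; ring.
- by rewrite a_0 mul0r.
- by rewrite qN expr0n mulr0.
- by rewrite a_0 a1_0 mulr0 !mul0r subrr.
- by rewrite qN !expr0n !mulr0 subrr.
Qed.

Lemma is_derive_cutoff1 x : is_derive x 1 (cutoff1 N a a1) (cutoff2 N a a1 a2 x).
Proof.
apply: restrict_is_derive => [{}x||||].
- have dq := is_derive_ramp N x.
  apply: (is_derive_eq (is_deriveB (is_deriveM (da1 x) (is_deriveX 3 dq))
    (is_deriveM (is_deriveM (is_derive_cst (3 / N) x (1 : R)) (da x)) (is_deriveX 2 dq)))).
  have -> : ((fun y : R => 1 - y / N) ^+ 3) x = (1 - x / N) ^+ 3 by [].
  have -> : ((fun y : R => 1 - y / N) ^+ 2) x = (1 - x / N) ^+ 2 by [].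
  by rewrite !fctE /= !scaleR_mul; field; rewrite gt_eqF.
- by rewrite a_0 a1_0 mulr0 !mul0r subrr.
- by rewrite qN !expr0n !mulr0 subrr.
- by rewrite a_0 a1_0 a2_0 !mulr0 !mul0r subrr addr0.
- by rewrite qN !expr0n !mulr0 subrr addr0.
Qed.

Lemma derive1_cutoff : derive1n 1 (cutoff N a) = cutoff1 N a a1.
Proof.
apply/funext => x; rewrite derive1n1 derive1E.
exact: (@derive_val _ _ _ _ _ _ _ (is_derive_cutoff x)).
Qed.

Lemma derive2_cutoff : derive1n 2 (cutoff N a) = cutoff2 N a a1 a2.
Proof.
apply/funext => x; rewrite derive1nS derive1_cutoff derive1E.
exact: (@derive_val _ _ _ _ _ _ _ (is_derive_cutoff1 x)).
Qed.

Lemma continuous_of_is_derive f f1 : (forall x, is_derive x 1 f (f1 x)) -> continuous f.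
Proof.
move=> df x; apply: differentiable_continuous; apply/derivable1_diffP.
exact: (@ex_derive _ _ _ _ _ _ _ (df x)).
Qed.

Lemma test_function_cutoff : test_function (cutoff N a).
Proof.
split.
- move=> x; exact: (@ex_derive _ _ _ _ _ _ _ (is_derive_cutoff x)).
- move=> x; rewrite derive1_cutoff; exact: (@ex_derive _ _ _ _ _ _ _ (is_derive_cutoff1 x)).
- rewrite derive2_cutoff; apply: restrict_continuous.
  + have cq : continuous (fun x : R => 1 - x / N).
      exact: (continuous_of_is_derive (is_derive_ramp N)).
    have ca := continuous_of_is_derive da.
    have ca1 := continuous_of_is_derive da1.
    have cX n (x : R) : (1 - y / N) ^+ n @[y --> x] --> (1 - x / N) ^+ n.
      exact: (cvg_comp _ _ (cq x) (@exprn_continuous _ _ _)).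
    move=> x; apply: cvgD; first apply: cvgB.
    * by apply: cvgM; [exact: ca2|exact: cX].
    * apply: cvgM; last exact: cX.
      by apply: cvgM; [exact: cvg_cst|exact: ca1].
    * apply: cvgM; last exact: cq.
      by apply: cvgM; [exact: cvg_cst|exact: ca].
  + by rewrite a_0 a1_0 a2_0 !mulr0 !mul0r subrr addr0.
  + by rewrite qN !expr0n !mulr0 subrr addr0.
- exists N => x Nx; rewrite /cutoff restrict_itvE ifF//; apply/negP => /andP[x0 xN].
  by move: Nx; rewrite gtr0_norm// ltNge (ltW xN).
Qed.

End gluing.

(** * Dominated convergence and sums of exponentials *)

Section dominated.
Context {R : realType}.

Lemma Rintegral_dominated d (T : measurableType d) (mu : {measure set T -> \bar R})
    (D : set T) (f_ : nat -> T -> R) (f g : T -> R) : measurable D ->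
  (forall n, measurable_fun D (f_ n)) -> measurable_fun D f ->
  {ae mu, forall x, D x -> f_ n x @[n --> \oo] --> f x} ->
  mu.-integrable D (EFin \o g) -> (forall n x, D x -> `|f_ n x| <= g x) ->
  mu.-integrable D (EFin \o f) /\
  \int[mu]_(x in D) f_ n x @[n --> \oo] --> \int[mu]_(x in D) f x.
Proof.
move=> mD mf_ mf f_f ig fg.
have h1 n : measurable_fun D (EFin \o f_ n) by exact/measurable_EFinP.
have h2 : measurable_fun D (EFin \o f) by exact/measurable_EFinP.
have h3 : {ae mu, forall x, D x -> (EFin \o f_ n) x @[n --> \oo] --> (EFin \o f) x}.
  by apply: filterS f_f => x h Dx; apply: cvg_EFin; [exact: nearW|exact: h].
have h4 : {ae mu, forall x n, D x -> (`|(EFin \o f_ n) x| <= (EFin \o g) x)%E}.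
  by apply: aeW => x n Dx; rewrite lee_fin fg.
have [iF _ cF] := dominated_convergence mD h1 h2 h3 ig h4.
split => //.
apply: fine_cvg; rewrite /Rintegral fineK//.
exact: integrable_fin_num.
Qed.

Lemma Laplace_dominated (s M : R) (f_ : nat -> R -> R) (f : R -> R) : 0 < s ->
  (forall n, measurable_fun (`]0, +oo[%classic : set R) (f_ n)) ->
  (forall n t, 0 < t -> `|f_ n t| <= M) ->
  (forall t, 0 < t -> f_ n t @[n --> \oo] --> f t) ->
  Laplace_integrable s f /\ Laplace s (f_ n) @[n --> \oo] --> Laplace s f.
Proof.
move=> s0 mf_ fM ff.
have mf : measurable_fun (`]0, +oo[%classic : set R) f.
  by apply: measurable_fun_cvg mf_ _ => // t; rewrite /= in_itv/= andbT; exact: ff.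
have mE g : measurable_fun (`]0, +oo[%classic : set R) g ->
    measurable_fun (`]0, +oo[%classic : set R) (fun t => expR (- (s * t)) * g t).
  move=> mg; apply: measurable_funM => //.
  by apply: measurable_funTS; exact: measurable_expRNM.
have [iM _] := Laplace_integrable_cst M s0.
apply: (Rintegral_dominated _ _ _ _ iM) => //.
- by move=> n; exact: mE.
- exact: mE.
- apply: aeW => t; rewrite /= in_itv/= andbT => t0.
  by apply: cvgM; [exact: cvg_cst|exact: ff].
- move=> n t; rewrite /= in_itv/= andbT => t0.
  by rewrite normrM ger0_norm ?expR_ge0// ler_wpM2l ?expR_ge0// fM.
Qed.

End dominated.

Section exponential_sums.
Context {R : realType}.
Implicit Types (l : seq (R * R)) (x : R).

Definition expsum l x : R := \sum_(p <- l) p.1 * expR (- (p.2 * x)).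

Definition dexpsum l : seq (R * R) := [seq (- (p.1 * p.2), p.2) | p <- l].

Lemma is_derive_expsum l x : is_derive x 1 (expsum l) (expsum (dexpsum l) x).
Proof.
rewrite /expsum /dexpsum big_map.
have -> : (fun x => \sum_(p <- l) p.1 * expR (- (p.2 * x))) =
    \sum_(p <- l) (fun x => p.1 * expR (- (p.2 * x))).
  by apply/funext => y; rewrite fct_sumE.
elim: l => [|p l IHl]; first by rewrite !big_nil; exact: is_derive_cst.
rewrite !big_cons; apply: is_deriveD IHl => /=.
have h1 := is_deriveZ (- p.2) (is_derive_id x (1 : R)).
have h2 := is_deriveZ p.1 (is_derive1_comp (is_derive_expR (- p.2 * x)) h1).
have -> : (fun x => p.1 * expR (- (p.2 * x))) = p.1 \*: (expR \o (- p.2 \*: id)).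
  by apply/funext => y; rewrite /= -[_ *: _]/(_ * _) -[_ *: y]/(_ * _) mulNr.
apply: (is_derive_eq h2).
by rewrite -![_ *: _]/(_ * _) /= mulr1 !mulNr; ring.
Qed.

Lemma continuous_expsum l : continuous (expsum l).
Proof. exact: (continuous_of_is_derive (is_derive_expsum l)). Qed.

Lemma expsum_bounded l x : all (fun p => 0 <= p.2) l -> 0 <= x ->
  `|expsum l x| <= \sum_(p <- l) `|p.1|.
Proof.
move=> /allP l0 x0; rewrite (le_trans (ler_norm_sum _ _ _))//.
rewrite big_seq [leRHS]big_seq ler_sum// => p /l0 p0.
rewrite normrM ler_piMr// ger0_norm ?expR_ge0// expR_le1 oppr_le0 mulr_ge0//.
Qed.

End exponential_sums.

(** * Expectations at the random time *)

Section random_time.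
Context {R : realType} {d : measure_display} {Omega : measurableType d}.
Variables (P : probability Omega R) (T : R -> Omega -> R) (alpha : R).
Hypothesis halpha : 0 < alpha <= 1.
Hypothesis hT : forall t, 0 < t -> measurable_fun setT (T t) /\ forall w, 0 <= T t w.
Hypothesis hfold : folded_solution alpha (fun t A => P (T t @^-1` A)).
Implicit Types (phi : R -> R) (s t x : R) (l : seq (R * R)).

Definition Ex phi t : R := \int[P]_w phi (T t w).

(** The law of T(t) evaluated at A depends only on the trace of A on the open
    half-line, hence it gives this half-line the same mass as R. *)
Lemma prob_positive t : 0 < t -> P (T t @^-1` `]0, +oo[) = 1%E.
Proof.
move=> t0; have [u _ hu] := hfold.
rewrite hu// setIid -[X in (_ * u t X)%E]setTI -hu//.
by rewrite preimage_setT probability_setT.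
Qed.

Lemma ae_positive t : 0 < t -> {ae P, forall w, 0 < T t w}.
Proof.
move=> t0; have [mT T0] := hT t0.
exists (T t @^-1` [set x | ~ 0 < x]); split.
- rewrite -[X in measurable X]setTI; apply: mT => //.
  rewrite (_ : mkset _ = `]-oo, 0]%classic); first exact: measurable_itv.
  by apply/seteqP; split => x /=; rewrite in_itv/= leNgt => /negP.
- rewrite (_ : _ @^-1` _ = ~` (T t @^-1` `]0, +oo[)); last first.
    by apply/seteqP; split => w /=; rewrite in_itv/= andbT.
  rewrite probability_setC ?prob_positive// ?subee//.
  by rewrite -[X in measurable X]setTI; apply: mT.
- by move=> w.
Qed.

Lemma Ex_integrable phi (M : R) t : 0 < t -> measurable_fun setT phi ->
  (forall x, 0 <= x -> `|phi x| <= M) ->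
  P.-integrable setT (fun w => (phi (T t w))%:E).
Proof.
move=> t0 mphi phiM; have [mT T0] := hT t0.
apply: (le_integrable _ _ _ (finite_measure_integrable_cst P M measurableT)) => //.
  by apply/measurable_EFinP; exact: (measurableT_comp mphi mT).
by move=> w _; rewrite lee_fin (le_trans (phiM _ (T0 w)))// ler_norm.
Qed.

Lemma Ex_le phi (M : R) t : 0 < t -> measurable_fun setT phi ->
  (forall x, 0 <= x -> `|phi x| <= M) -> `|Ex phi t| <= M.
Proof.
move=> t0 mphi phiM; have iphi := Ex_integrable t0 mphi phiM.
rewrite (le_trans (le_normr_Rintegral _ iphi))//.
have iM := finite_measure_integrable_cst P M measurableT.
rewrite (le_trans (le_Rintegral (f2 := cst M) _ (integrable_norm iphi) iM _))//.
  by move=> w _; apply: phiM; exact: (hT t0).2.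
by rewrite Rintegral_cst//= probability_setT mulr1.
Qed.

Lemma Ex_cvg (phi_ : nat -> R -> R) phi (M : R) t : 0 < t ->
  (forall n, measurable_fun setT (phi_ n)) -> measurable_fun setT phi ->
  (forall n x, 0 <= x -> `|phi_ n x| <= M) ->
  (forall x, 0 < x -> phi_ n x @[n --> \oo] --> phi x) ->
  Ex (phi_ n) t @[n --> \oo] --> Ex phi t.
Proof.
move=> t0 mphi_ mphi phiM phic; have [mT T0] := hT t0.
apply: (Rintegral_dominated (g := cst M) _ _ _ _ _ _).2 => //.
- by move=> n; exact: measurableT_comp.
- exact: measurableT_comp.
- by apply: filterS (ae_positive t0) => w Tw _; exact: phic.
- exact: finite_measure_integrable_cst.
- by move=> n w _; exact: phiM.
Qed.

(** The law of T(t) is twice the restriction of u(t) to the open half-line.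
    Splitting phi into its positive and negative parts reduces the claim to
    nonnegative functions. *)
Lemma Ex_pairing (u : R -> probability (measurableTypeR R) R) phi (M : R) t :
  (forall t, 0 < t -> forall A : set R, measurable A ->
      P (T t @^-1` A) = (2%:E * u t (A `&` `]0, +oo[)%R)%E) ->
  0 < t -> measurable_fun setT phi -> (forall x, `|phi x| <= M) ->
  (forall x, x <= 0 -> phi x = 0) ->
  pairing u phi t = 2^-1 * Ex phi t.
Proof.
move=> hu t0.
have [mT T0] := hT t0.
wlog phi0 : phi / (forall x, 0 <= phi x).
  move=> H mphi phiM phi_0.
  pose p1 x := Num.max (phi x) 0; pose p2 x := Num.max (- phi x) 0.
  have E : phi = p1 \- p2.
    apply/funext => x; rewrite /p1 /p2 /=; have [h|h] := leP 0 (phi x).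
      by rewrite max_r ?subr0// oppr_le0.
    by rewrite max_l ?sub0r ?opprK// oppr_ge0 ltW.
  have m1 : measurable_fun setT p1 by exact: measurable_maxr.
  have m2 : measurable_fun setT p2.
    by apply: measurable_maxr => //; apply: measurable_funN.
  have M0 : 0 <= M by exact: le_trans (phiM 0).
  have b1 x : `|p1 x| <= M by rewrite /p1; have [_|_] := leP (phi x) 0; rewrite ?normr0.
  have b2 x : `|p2 x| <= M by rewrite /p2; have [_|_] := leP (- phi x) 0; rewrite ?normr0 ?normrN.
  have z1 x : x <= 0 -> p1 x = 0 by move=> x0; rewrite /p1 phi_0// maxxx.
  have z2 x : x <= 0 -> p2 x = 0 by move=> x0; rewrite /p2 phi_0// oppr0 maxxx.
  have iu (p : R -> R) : measurable_fun setT p -> (forall x, `|p x| <= M) ->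
      (u t).-integrable setT (EFin \o p).
    move=> mp pM; apply: (le_integrable _ _ _ (finite_measure_integrable_cst (u t) M measurableT)) => //.
      exact/measurable_EFinP.
    by move=> x _; rewrite lee_fin (le_trans (pM x))// ler_norm.
  have -> : pairing u phi t = pairing u p1 t - pairing u p2 t.
    by rewrite /pairing -RintegralB//; [rewrite E|exact: iu|exact: iu].
  have -> : Ex phi t = Ex p1 t - Ex p2 t.
    rewrite /Ex -RintegralB//; [by rewrite E| |];
      by apply: (@Ex_integrable _ M).
  rewrite !H//; first by ring.
  by move=> x; rewrite /p2 le_max lexx orbT.
  by move=> x; rewrite /p1 le_max lexx orbT.
move=> mphi phiM phi_0.
have mD : measurable (`]0%R, +oo[%classic : set R) by exact: measurable_itv.
have H : (\int[u t]_x (phi x)%:E = 2^-1%:E * \int[P]_w (phi (T t w))%:E)%E.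
  transitivity (\int[u t]_(x in `]0%R, +oo[) (phi x)%:E)%E.
    rewrite [RHS]integral_mkcond; apply: eq_integral => x _.
    rewrite patchE mem_setE in_itv/= andbT; case: ltP => // x0.
    by rewrite phi_0.
  have mT' : measurable_fun setT (T t : Omega -> measurableTypeR R) := mT.
  pose push : {measure set (measurableTypeR R) -> \bar R} :=
    measure_function_pushforward__canonical__measure_function_Measure P mT'.
  rewrite (eq_measure_integral (mscale (2^-1)%:nng push)); last first.
    move=> A mA A0; transitivity (2^-1%:E * P (T t @^-1` A))%E => //; rewrite hu//.
    rewrite (_ : A `&` _ = A); last exact/setIidPl.
    by rewrite muleA -EFinM mulVf ?mul1e// .
  rewrite ge0_integral_mscale//=; last 2 first.
  - by apply/measurable_EFinP; exact: measurable_funTS.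
  - by move=> x _; rewrite lee_fin.
  congr (_ * _)%E.
  rewrite ge0_integral_pushforward//=; last 2 first.
  - by apply/measurable_EFinP; exact: measurable_funTS.
  - by move=> x _; rewrite lee_fin.
  rewrite integral_mkcond; apply: eq_integral => w _.
  rewrite patchE; case: ifPn => //= h; rewrite phi_0//.
  rewrite leNgt; apply: contra h => h; rewrite inE/= in_itv/= andbT//.
rewrite /pairing /Ex /Rintegral H fineM//.
apply: integrable_fin_num => //.
by apply: (@Ex_integrable _ M).
Qed.

End random_time.

(** * The diffusion equation in expectations *)

Section cutoff_limits.
Context {R : realType}.
Implicit Types (a : R -> R) (x C : R).

Lemma ramp_cvg x : 1 - x / n.+1%:R @[n --> \oo] --> (1 : R).
Proof.
rewrite -[X in _ --> X](subr0 1) -[X in _ --> _ - X](mulr0 x).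
apply: cvgB; first exact: cvg_cst.
by apply: cvgM; [exact: cvg_cst|exact: cvg_harmonic].
Qed.

Lemma near_in_cutoff x : 0 < x -> \forall n \near \oo, 0 < x < n.+1%:R.
Proof.
move=> x0; near=> n; rewrite x0/= (lt_trans (truncnS_gt x))// ltr_nat ltnS.
by near: n; exact: nbhs_infty_gt.
Unshelve. all: by end_near. Qed.

Lemma cutoff_cvg a x : 0 < x -> cutoff n.+1%:R a x @[n --> \oo] --> a x.
Proof.
move=> x0; have h : a x * (1 - x / n.+1%:R) ^+ 3 @[n --> \oo] --> a x * 1 ^+ 3.
  apply: cvgM; first exact: cvg_cst.
  exact: (cvg_comp _ _ (ramp_cvg x) (@exprn_continuous _ 3 1)).
rewrite expr1n mulr1 in h; apply: cvg_trans h; apply: near_eq_cvg.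
by apply: filterS (near_in_cutoff x0) => n xn; rewrite /cutoff restrict_itvE xn.
Qed.

Lemma cutoff2_cvg a a1 a2 x : 0 < x -> cutoff2 n.+1%:R a a1 a2 x @[n --> \oo] --> a2 x.
Proof.
move=> x0; have r := ramp_cvg x.
have rX k : (1 - x / n.+1%:R) ^+ k @[n --> \oo] --> (1 : R) ^+ k.
  exact: (cvg_comp _ _ r (@exprn_continuous _ k 1)).
have h : a2 x * (1 - x / n.+1%:R) ^+ 3 - 6 / n.+1%:R * a1 x * (1 - x / n.+1%:R) ^+ 2
     + 6 / n.+1%:R ^+ 2 * a x * (1 - x / n.+1%:R) @[n --> \oo] -->
   a2 x * 1 ^+ 3 - 6 * 0 * a1 x * 1 ^+ 2 + 6 * 0 ^+ 2 * a x * 1.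
  have ch : (n.+1%:R^-1 : R) @[n --> \oo] --> (0 : R) by exact: cvg_harmonic.
  apply: cvgD; first apply: cvgB.
  - by apply: cvgM; [exact: cvg_cst|exact: rX].
  - apply: cvgM; last exact: rX.
    apply: cvgM; last exact: cvg_cst.
    by apply: cvgM; [exact: cvg_cst|exact: ch].
  - apply: cvgM; last exact: r.
    apply: cvgM; last exact: cvg_cst.
    apply: cvgM; first exact: cvg_cst.
    under eq_fun do rewrite -exprVn.
    exact: (cvg_comp _ _ ch (@exprn_continuous _ 2 0)).
rewrite !expr1n expr0n !mulr0 !mul0r mulr1 subr0 addr0 in h.
apply: cvg_trans h; apply: near_eq_cvg.
by apply: filterS (near_in_cutoff x0) => n xn; rewrite /cutoff2 restrict_itvE xn.
Qed.

Lemma cutoff_bounded a C n x : (forall y, 0 <= y -> `|a y| <= C) ->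
  `|cutoff n.+1%:R a x| <= C.
Proof.
move=> aC; have C0 : 0 <= C by exact: le_trans (aC 0 (lexx 0)).
rewrite /cutoff restrict_itvE; case: ifPn => [/andP[x0 xn]|_]; last by rewrite normr0.
have q0 : 0 <= 1 - x / n.+1%:R by rewrite subr_ge0 ler_pdivrMr// mul1r ltW.
have q1 : 1 - x / n.+1%:R <= 1 by rewrite gerBl divr_ge0// ltW.
rewrite normrM -[leRHS]mulr1 ler_pM// ?aC ?(ltW x0)//.
by rewrite ger0_norm ?exprn_ge0// exprn_ile1.
Qed.

Lemma cutoff2_bounded a a1 a2 C n x :
  (forall y, 0 <= y -> `|a y| <= C) -> (forall y, 0 <= y -> `|a1 y| <= C) ->
  (forall y, 0 <= y -> `|a2 y| <= C) -> `|cutoff2 n.+1%:R a a1 a2 x| <= 13 * C.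
Proof.
move=> aC a1C a2C; have C0 : 0 <= C by exact: le_trans (aC 0 (lexx 0)).
rewrite /cutoff2 restrict_itvE; case: ifPn => [/andP[x0 xn]|_]; last by rewrite normr0 mulr_ge0.
have q0 : 0 <= 1 - x / n.+1%:R by rewrite subr_ge0 ler_pdivrMr// mul1r ltW.
have q1 : 1 - x / n.+1%:R <= 1 by rewrite gerBl divr_ge0// ltW.
set q := 1 - _ in q0 q1 *.
have i0 : 0 <= (n.+1%:R^-1 : R) by rewrite invr_ge0.
have i1 : (n.+1%:R^-1 : R) <= 1 by rewrite invf_le1// ler1n.
have b z k : `|z| <= C -> `|z * q ^+ k| <= C.
  move=> zC; rewrite normrM -[leRHS]mulr1 ler_pM//.
  by rewrite ger0_norm ?exprn_ge0// exprn_ile1.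
have b' z (r : R) : 0 <= r <= 1 -> `|z| <= C -> `|6 * r * z| <= 6 * C.
  move=> /andP[r0 r1] zC; rewrite -mulrA normrM ger0_norm// ler_wpM2l// normrM ger0_norm//.
  by rewrite -[leRHS]mul1r ler_pM.
have -> : 13 * C = C + 6 * C + 6 * C by ring.
rewrite (le_trans (ler_normD _ _))// lerD//.
  rewrite (le_trans (ler_normB _ _))// lerD// ?b ?a2C ?(ltW x0)//.
  by rewrite -mulrA b' ?i0// b ?a1C ?(ltW x0).
rewrite -mulrA b'//; last by rewrite -(expr1 q) b ?aC ?(ltW x0).
by rewrite invr_ge0 exprn_ge0//= -exprVn exprn_ile1.
Qed.

End cutoff_limits.

Section random_time_laplace.
Context {R : realType} {d : measure_display} {Omega : measurableType d}.
Variables (P : probability Omega R) (T : R -> Omega -> R) (alpha : R).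
Hypothesis halpha : 0 < alpha <= 1.
Hypothesis hT : forall t, 0 < t -> measurable_fun setT (T t) /\ forall w, 0 <= T t w.
Hypothesis hfold : folded_solution alpha (fun t A => P (T t @^-1` A)).
Implicit Types (phi : R -> R) (s t x : R) (l : seq (R * R)).

Local Notation Ex := (Ex P T).

(** The lists whose sum of exponentials, extended by 0 to the left half-line, is
    a bounded function of class C^2. *)
Definition flat l := [/\ all (fun p => 0 <= p.2) l, expsum l 0 = 0,
  expsum (dexpsum l) 0 = 0 & expsum (dexpsum (dexpsum l)) 0 = 0].

Lemma all_dexpsum l : all (fun p : R * R => 0 <= p.2) l ->
  all (fun p : R * R => 0 <= p.2) (dexpsum l).
Proof. by move=> /allP h; apply/allP => _ /mapP[p pl ->]; exact: (h p pl). Qed.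

Lemma expsum_common_bound l : all (fun p => 0 <= p.2) l -> exists C,
  [/\ forall x, 0 <= x -> `|expsum l x| <= C,
      forall x, 0 <= x -> `|expsum (dexpsum l) x| <= C &
      forall x, 0 <= x -> `|expsum (dexpsum (dexpsum l)) x| <= C].
Proof.
move=> l0; have l1 := all_dexpsum l0; have l2 := all_dexpsum l1.
pose S l := \sum_(p <- l) `|p.1| : R.
have S0 k : 0 <= S k by exact: sumr_ge0.
exists (S l + S (dexpsum l) + S (dexpsum (dexpsum l))).
have := S0 l; have := S0 (dexpsum l); have := S0 (dexpsum (dexpsum l)).
move=> h2 h1 h0; split => x x0; rewrite (le_trans (expsum_bounded _ x0))//.
- by rewrite -/(S _) -addrA lerDl addr_ge0.
- by rewrite -/(S _) addrAC lerDr addr_ge0.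
- by rewrite -/(S _) lerDr addr_ge0.
Qed.

Lemma measurable_cutoff N l : flat l -> 0 < N -> measurable_fun setT (cutoff N (expsum l)).
Proof.
move=> [_ l0 l1 l2] N0; apply: continuous_measurable_fun.
exact: (continuous_of_is_derive (is_derive_cutoff N0 (is_derive_expsum l) l0 l1)).
Qed.

(** The cut-off function is a test function that vanishes on the left half-line,
    so its pairing with the fundamental solution is half its expectation at
    T(t), and the initial value in [Caputo_Laplace] is 0. *)
Lemma Ex_cutoff l n : flat l ->
  let a := expsum l in let a1 := expsum (dexpsum l) in
  let a2 := expsum (dexpsum (dexpsum l)) in
  [/\ forall t, 0 < t -> {for t, continuous (Ex (cutoff n.+1%:R a))},
      measurable_fun (`]0, +oo[%classic : set R) (Ex (cutoff2 n.+1%:R a a1 a2)) &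
      forall s, 0 < s ->
        Laplace s (Ex (cutoff n.+1%:R a)) = s `^ (- (2 * alpha)) * Laplace s (Ex (cutoff2 n.+1%:R a a1 a2))].
Proof.
move=> fl a a1 a2; have [l0 a_0 a1_0 a2_0] := fl.
have [C [aC a1C a2C]] := expsum_common_bound l0.
have [u fu hu] := hfold.
pose N : R := n.+1%:R; have N0 : 0 < N by [].
have da := is_derive_expsum l; have da1 := is_derive_expsum (dexpsum l).
have ca2 := @continuous_expsum R (dexpsum (dexpsum l)).
have tf := test_function_cutoff N0 da da1 ca2 a_0 a1_0 a2_0.
have d2 := derive2_cutoff N0 da da1 a_0 a1_0 a2_0.
have [cd ce c0 c1] := fu _ tf.
rewrite d2 in ce.
have z x : x <= 0 -> cutoff N a x = 0.
  by move=> x0; rewrite /cutoff restrict_itvE ltNge x0.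
have z2 x : x <= 0 -> cutoff2 N a a1 a2 x = 0.
  by move=> x0; rewrite /cutoff2 restrict_itvE ltNge x0.
have m0 := measurable_cutoff fl N0.
have m2 : measurable_fun setT (cutoff2 N a a1 a2).
  by apply: continuous_measurable_fun; case: tf => _ _; rewrite d2.
have b0 x : `|cutoff N a x| <= C by exact: cutoff_bounded.
have b2 x : `|cutoff2 N a a1 a2 x| <= 13 * C by exact: cutoff2_bounded.
have E0 t : 0 < t -> pairing u (cutoff N a) t = 2^-1 * Ex (cutoff N a) t.
  by move=> t0; apply: Ex_pairing b0 z.
have E2 t : 0 < t -> pairing u (cutoff2 N a a1 a2) t = 2^-1 * Ex (cutoff2 N a a1 a2) t.
  by move=> t0; apply: Ex_pairing b2 z2.
have E0' t : 0 < t -> 2 * pairing u (cutoff N a) t = Ex (cutoff N a) t.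
  by move=> t0; rewrite E0// mulrA mulfV// mul1r.
have E2' t : 0 < t -> 2 * pairing u (cutoff2 N a a1 a2) t = Ex (cutoff2 N a a1 a2) t.
  by move=> t0; rewrite E2// mulrA mulfV// mul1r.
have /andP[al0 al1] := halpha.
have ab : 0 < 2 * alpha <= 2 by apply/andP; split; lra.
have [mc _] := caputo_primitive ab cd.
have m2' : measurable_fun (`]0, +oo[%classic : set R) (Ex (cutoff2 N a a1 a2)).
  apply: (@eq_measurable_fun _ _ _ _ _ (fun t => 2 * caputo (2 * alpha) (pairing u (cutoff N a)) t)).
    by move=> t; rewrite inE/= in_itv/= andbT => t0; rewrite ce// E2'.
  exact: measurable_funM.
rewrite z// in c0.
rewrite -/N; split => //.
  have [dk _] := cd.
  have m1 : (0 < caputo_order (2 * alpha))%N.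
    have [h|h] := leP (2 * alpha) 1; first by rewrite caputo_order1//; lra.
    by rewrite caputo_order2//; lra.
  have H := dk 0%N m1.
  have H0 := primitive_from_0 H c0.
  have Hi t : 0 < t -> lebesgue_measure.-integrable `[0, t] (EFin \o derive1n 1 (pairing u (cutoff N a))).
    by move=> t0; exact: (H t t t0 (lexx t)).1.
  move=> t t0; have ct := primitive_continuous Hi H0 t0.
  suff : Ex (cutoff N a) v @[v --> t] --> Ex (cutoff N a) t by [].
  rewrite -[X in _ --> X]E0'//.
  have h : 2 * pairing u (cutoff N a) v @[v --> t] --> 2 * pairing u (cutoff N a) t.
    by apply: cvgM; [exact: cvg_cst|exact: ct].
  apply: cvg_trans h; apply: near_eq_cvg; near=> v.
  by rewrite E0'//; near: v; exact: lt_nbhsr.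
move=> s s0.
have c1' : 1 < 2 * alpha -> derive1n 1 (pairing u (cutoff N a)) t @[t --> 0^'+] --> (0 : R).
  by move=> h; apply: c1; lra.
have gM t : 0 < t -> `|caputo (2 * alpha) (pairing u (cutoff N a)) t| <= 13 * C.
  move=> t0; rewrite ce// E2// normrM ger0_norm ?invr_ge0//.
  rewrite -[leRHS]mul1r ler_pM ?invr_ge0//; first by rewrite invf_le1 ?ler1n.
  by apply: Ex_le => // x _; exact: b2.
have [iL LL] := Caputo_Laplace ab s0 cd c0 c1' gM.
have ic : Laplace_integrable s (caputo (2 * alpha) (pairing u (cutoff N a))) by exact: Laplace_integrable_bounded mc gM.
rewrite -(Laplace_eq s E0') LaplaceZ// LL mul0r add0r.
have -> : Laplace s (Ex (cutoff2 N a a1 a2)) = 2 * Laplace s (caputo (2 * alpha) (pairing u (cutoff N a))).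
  by rewrite -LaplaceZ//; apply: Laplace_eq => t t0; rewrite ce// E2'.
by rewrite mulrCA.
Unshelve. all: by end_near. Qed.

End random_time_laplace.

(** * Exponential moments of the random time *)

Section laplace_exponent.
Context {R : realType} {d : measure_display} {Omega : measurableType d}.
Variables (P : probability Omega R) (T : R -> Omega -> R) (alpha : R).
Hypothesis halpha : 0 < alpha <= 1.
Hypothesis hT : forall t, 0 < t -> measurable_fun setT (T t) /\ forall w, 0 <= T t w.
Hypothesis hfold : folded_solution alpha (fun t A => P (T t @^-1` A)).
Implicit Types (phi : R -> R) (s t x m : R) (l : seq (R * R)).

Local Notation Ex := (Ex P T).

Definition expT m : R -> R := Ex (fun x => expR (- (m * x))).

Lemma expRN_bounded m x : 0 <= m -> 0 <= x -> `|expR (- (m * x))| <= 1.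
Proof.
by move=> m0 x0; rewrite ger0_norm ?expR_ge0// expR_le1 oppr_le0 mulr_ge0.
Qed.

Lemma Ex_expsum l t : 0 < t -> all (fun p => 0 <= p.2) l ->
  Ex (expsum l) t = \sum_(p <- l) p.1 * expT p.2 t.
Proof.
move=> t0; elim: l => [_|p l IHl /= /andP[p0 l0]].
  rewrite big_nil /Ex; under eq_Rintegral do rewrite /expsum big_nil.
  by rewrite Rintegral_cst// mul0r.
have ip := Ex_integrable P hT t0 (measurable_expRNM p.2) (fun x => expRN_bounded p0).
have il := Ex_integrable P hT t0 (continuous_measurable_fun (@continuous_expsum R l))
  (fun x => expsum_bounded l0).
rewrite big_cons -IHl// /expT /Ex -RintegralZl//.
rewrite -RintegralD//; last exact: (integrableZl measurableT p.1 ip).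
by apply: eq_Rintegral => w _; rewrite /expsum big_cons.
Qed.

(** The expansion of exp(- m x) (1 - exp(- nu x))^3: it vanishes to third order
    at 0, and approaches exp(- m x) for x > 0 when nu tends to infinity. *)
Definition bump_list (nu m : R) : seq (R * R) :=
  [:: (1, m); (- 3, m + nu); (3, m + 2 * nu); (- 1, m + 3 * nu)].

Lemma expsum_bump_list nu m x :
  expsum (bump_list nu m) x = expR (- (m * x)) * (1 - expR (- (nu * x))) ^+ 3.
Proof.
rewrite /expsum /bump_list !big_cons big_nil /=.
have -> : - ((m + nu) * x) = - (m * x) + - (nu * x) by ring.
have -> : - ((m + 2 * nu) * x) = - (m * x) + (- (nu * x) + - (nu * x)) by ring.
have -> : - ((m + 3 * nu) * x) = - (m * x) + (- (nu * x) + (- (nu * x) + - (nu * x))) by ring.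
by rewrite !expRD; ring.
Qed.

Lemma flat_bump_list nu m : 0 <= nu -> 0 <= m -> flat (bump_list nu m).
Proof.
move=> nu0 m0; split.
- by rewrite /= m0 !addr_ge0// mulr_ge0.
- by rewrite expsum_bump_list !mulr0 oppr0 expR0 subrr expr0n mulr0.
- rewrite /expsum /dexpsum /bump_list !big_cons big_nil /= !mulr0 oppr0 expR0; ring.
- rewrite /expsum /dexpsum /bump_list !big_cons big_nil /= !mulr0 oppr0 expR0; ring.
Qed.

(** The law of T(t) has mass 1 on the open half-line for every t, so the mass left
    out by a test function close to 1 stays small for nearby times, while the
    expectations of test functions are continuous in t. *)
Lemma expT_continuous m t : 0 <= m -> 0 < t -> {for t, continuous (expT m)}.
Proof.
move=> m0 t0.
pose nu n : R := n.+1%:R.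
pose chi n : R -> R := cutoff n.+1%:R (expsum (bump_list (nu n) 0)).
pose psi n : R -> R := cutoff n.+1%:R (expsum (bump_list (nu n) m)).
have nu0 n : 0 <= nu n by [].
have fchi n := flat_bump_list (nu0 n) (lexx 0).
have fpsi n := flat_bump_list (nu0 n) m0.
have chi01 n x : 0 <= chi n x <= 1.
  rewrite /chi /cutoff restrict_itvE; case: ifPn => [/andP[x0 xn]|_]; last by rewrite lexx ler01.
  rewrite expsum_bump_list mul0r oppr0 expR0 mul1r.
  have q0 : 0 <= 1 - x / n.+1%:R by rewrite subr_ge0 ler_pdivrMr// mul1r ltW.
  have q1 : 1 - x / n.+1%:R <= 1 by rewrite gerBl divr_ge0// ltW.
  have r0 : 0 <= 1 - expR (- (nu n * x)).
    by rewrite subr_ge0 expR_le1 oppr_le0 mulr_ge0// ltW.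
  have r1 : 1 - expR (- (nu n * x)) <= 1 by rewrite gerBl expR_ge0.
  rewrite mulr_ge0 ?exprn_ge0//= -[leRHS]mul1r ler_pM ?exprn_ge0 ?exprn_ile1//.
have psiE n x : psi n x = expR (- (m * x)) * chi n x.
  rewrite /psi /chi /cutoff !restrict_itvE; case: ifP => _; last by rewrite mulr0.
  by rewrite !expsum_bump_list mul0r oppr0 expR0 mul1r mulrA.
have chib n x : 0 <= x -> `|chi n x| <= 1.
  by move=> _; have /andP[c0 c1] := chi01 n x; rewrite ger0_norm.
have mchi n : measurable_fun setT (chi n) by exact: measurable_cutoff.
have mpsi n : measurable_fun setT (psi n) by exact: measurable_cutoff.
have chi1 x : 0 < x -> chi n x @[n --> \oo] --> (1 : R).
  move=> x0.
  have e0 : expR (- (nu n * x)) @[n --> \oo] --> (0 : R).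
    have -> : (fun n => expR (- (nu n * x))) = (fun n => expR (- x) ^+ n.+1).
      by apply/funext => n; rewrite -expRM_natl mulrN.
    rewrite (cvg_shiftS (fun n => expR (- x) ^+ n)).
    by apply: cvg_expr; rewrite ger0_norm ?expR_ge0// expR_lt1 oppr_lt0.
  have h : (1 - expR (- (nu n * x))) ^+ 3 * (1 - x / n.+1%:R) ^+ 3
      @[n --> \oo] --> (1 - 0 : R) ^+ 3 * 1 ^+ 3.
    apply: cvgM; last exact: (cvg_comp _ _ (ramp_cvg x) (@exprn_continuous _ 3 1)).
    have hq : 1 - expR (- (nu n * x)) @[n --> \oo] --> (1 - 0 : R).
      by apply: cvgB; [exact: cvg_cst|exact: e0].
    exact: (cvg_comp _ _ hq (@exprn_continuous _ 3 (1 - 0))).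
  rewrite subr0 !expr1n mulr1 in h; apply: cvg_trans h; apply: near_eq_cvg.
  apply: filterS (near_in_cutoff x0) => n xn.
  by rewrite /chi /cutoff restrict_itvE xn expsum_bump_list mul0r oppr0 expR0 mul1r.
have Echi : Ex (chi n) t @[n --> \oo] --> (1 : R).
  rewrite (_ : 1 = Ex (cst 1) t); last first.
    by rewrite /Ex Rintegral_cst//= probability_setT mulr1.
  have mc : measurable_fun setT (cst 1 : R -> R) by exact: measurable_cst.
  exact: (Ex_cvg hT hfold t0 mchi mc chib chi1).
have gap n v : 0 < v -> `|expT m v - Ex (psi n) v| <= 1 - Ex (chi n) v.
  move=> v0.
  have ie := Ex_integrable P hT v0 (measurable_expRNM m) (fun x => expRN_bounded m0).
  have psib x : 0 <= x -> `|psi n x| <= 1.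
    by move=> x0; rewrite psiE normrM -[leRHS]mul1r ler_pM ?expRN_bounded ?chib.
  have ip := Ex_integrable P hT v0 (mpsi n) psib.
  have ic := Ex_integrable P hT v0 (mchi n) (chib n).
  have i1 : P.-integrable setT (fun w : Omega => (1 : R)%:E).
    exact: finite_measure_integrable_cst.
  have -> : 1 - Ex (chi n) v = \int[P]_w (1 - chi n (T v w)).
    by rewrite RintegralB// Rintegral_cst//= probability_setT mulr1.
  rewrite /expT /Ex -RintegralB//.
  have iB := integrableB _ ie ip; have iC := integrableB _ i1 ic.
  rewrite (le_trans (le_normr_Rintegral _ (iB measurableT)))//.
  apply: le_Rintegral => //.
  - exact: (integrable_norm (iB measurableT)).
  - exact: (iC measurableT).
  - move=> w _; rewrite psiE -[X in `|X - _|]mulr1 -mulrBr normrM.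
    have /andP[c0 c1] := chi01 n (T v w).
    rewrite [X in _ * X]ger0_norm ?subr_ge0// -[leRHS]mul1r ler_wpM2r ?subr_ge0//.
    exact: (expRN_bounded m0 ((hT v0).2 w)).
apply/cvgrPdist_lt => e e0.
have e4 : 0 < e / 4 by rewrite divr_gt0.
have [n hn] : exists n, `|1 - Ex (chi n) t| < e / 4.
  move/cvgrPdist_lt : Echi => /(_ _ e4) [n _ hn]; exists n; exact: (hn n (leqnn n)).
have [cchi _ _] := Ex_cutoff halpha hT hfold n (fchi n).
have [cpsi _ _] := Ex_cutoff halpha hT hfold n (fpsi n).
have {}cchi := cchi t t0; have {}cpsi := cpsi t t0.
move/cvgrPdist_lt : cchi => /(_ _ e4) cchi.
move/cvgrPdist_lt : cpsi => /(_ _ e4) cpsi.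
near=> v.
have v0 : 0 < v by near: v; exact: lt_nbhsr.
have g1 := gap n t t0; have g2 := gap n v v0.
have h1 : `|Ex (chi n) t - Ex (chi n) v| < e / 4 by near: v.
have h2 : `|Ex (psi n) t - Ex (psi n) v| < e / 4 by near: v.
move: hn h1 h2 g1 g2.
set A := expT m t; set B := expT m v; set a := Ex (psi n) t; set b := Ex (psi n) v.
rewrite !ltr_norml !ler_norml => /andP[? ?] /andP[? ?] /andP[? ?] /andP[? ?] /andP[? ?].
apply/andP; split; lra.
Unshelve. all: by end_near. Qed.

Lemma expT_bounded m t : 0 <= m -> 0 < t -> `|expT m t| <= 1.
Proof.
move=> m0 t0; rewrite /expT.
exact: (Ex_le P hT t0 (measurable_expRNM m) (fun x => expRN_bounded m0)).
Qed.

Lemma Laplace_integrable_expT m s : 0 <= m -> 0 < s -> Laplace_integrable s (expT m).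
Proof.
move=> m0 s0; apply: (Laplace_integrable_bounded s0) => [|t]; last exact: expT_bounded.
by apply: continuous_measurable_pos => t; exact: expT_continuous.
Qed.

Lemma Laplace_Ex_expsum s l : 0 < s -> all (fun p => 0 <= p.2) l ->
  Laplace s (Ex (expsum l)) = \sum_(p <- l) p.1 * Laplace s (expT p.2).
Proof.
move=> s0 l0.
rewrite (@Laplace_eq _ s _ (fun t => \sum_(p <- l | p \in l) p.1 * expT p.2 t)); last first.
  by move=> t t0; rewrite Ex_expsum// big_seq.
have iT p : p \in l -> Laplace_integrable s (expT p.2).
  by move=> pl; apply: Laplace_integrable_expT => //; exact: (allP l0).
have [_ ->] := @Laplace_integrable_sum R s _ l (fun p => p \in l) (fun p t => p.1 * expT p.2 t)
  (fun p pl => Laplace_integrable_Z p.1 (iT p pl)).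
by rewrite [RHS]big_seq; apply: eq_bigr => p pl; rewrite LaplaceZ//; exact: iT.
Qed.

(** Removing the cut-off in [Ex_cutoff]: each term exp(- p x) is an eigenfunction
    of the second derivative, for the eigenvalue p^2. *)
Lemma Laplace_expsum s l : 0 < s -> flat l ->
  \sum_(p <- l) p.1 * ((s `^ alpha) ^+ 2 - p.2 ^+ 2) * Laplace s (expT p.2) = 0.
Proof.
move=> s0 fl; have [l0 a_0 a1_0 a2_0] := fl.
have [C [aC a1C a2C]] := expsum_common_bound l0.
pose a := expsum l; pose a1 := expsum (dexpsum l); pose a2 := expsum (dexpsum (dexpsum l)).
pose f n : R -> R := Ex (cutoff n.+1%:R a).
pose g n : R -> R := Ex (cutoff2 n.+1%:R a a1 a2).
have m0 n : measurable_fun setT (cutoff n.+1%:R a) by exact: measurable_cutoff.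
have m2 n : measurable_fun setT (cutoff2 n.+1%:R a a1 a2).
  apply: continuous_measurable_fun.
  have [_ _] := test_function_cutoff (ltr0Sn R n) (is_derive_expsum l)
    (is_derive_expsum (dexpsum l)) (@continuous_expsum R (dexpsum (dexpsum l))) a_0 a1_0 a2_0.
  by rewrite (derive2_cutoff (ltr0Sn R n) (is_derive_expsum l) (is_derive_expsum (dexpsum l)) a_0 a1_0 a2_0).
have ma := continuous_measurable_fun (@continuous_expsum R l).
have ma2 := continuous_measurable_fun (@continuous_expsum R (dexpsum (dexpsum l))).
have bf n x : `|cutoff n.+1%:R a x| <= C by exact: cutoff_bounded.
have bg n x : `|cutoff2 n.+1%:R a a1 a2 x| <= 13 * C by exact: cutoff2_bounded.
have [_ Lf] := @Laplace_dominated R s C f (Ex a) s0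
  (fun n => continuous_measurable_pos (let: And3 h _ _ := Ex_cutoff halpha hT hfold n fl in h))
  (fun n t pt => Ex_le P hT pt (m0 n) (fun x _ => bf n x))
  (fun t pt => Ex_cvg hT hfold pt m0 ma (fun n x _ => bf n x) (fun x px => @cutoff_cvg R a x px)).
have [_ Lg] := @Laplace_dominated R s (13 * C) g (Ex a2) s0
  (fun n => let: And3 _ h _ := Ex_cutoff halpha hT hfold n fl in h)
  (fun n t pt => Ex_le P hT pt (m2 n) (fun x _ => bg n x))
  (fun t pt => Ex_cvg hT hfold pt m2 ma2 (fun n x _ => bg n x) (fun x px => @cutoff2_cvg R a a1 a2 x px)).
have fg n : s `^ (2 * alpha) * Laplace s (f n) = Laplace s (g n).
  have [_ _ h] := Ex_cutoff halpha hT hfold n fl.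
  rewrite h// mulrA -powRD; last by apply/implyP => _; rewrite gt_eqF.
  by rewrite subrr powRr0 mul1r.
have L1 : s `^ (2 * alpha) * Laplace s (f n) @[n --> \oo] --> s `^ (2 * alpha) * Laplace s (Ex a).
  by apply: cvgM; [exact: cvg_cst|exact: Lf].
have E : s `^ (2 * alpha) * Laplace s (Ex a) = Laplace s (Ex a2).
  apply: cvg_unique L1 _; first exact: Rhausdorff.
  by apply: cvg_trans Lg; apply: near_eq_cvg; apply: nearW => n; rewrite fg.
have s2 : s `^ (2 * alpha) = (s `^ alpha) ^+ 2.
  by rewrite mulrC powRrM -[2]/(2%:R) powR_mulrn ?powR_ge0.
have l2 := all_dexpsum (all_dexpsum l0).
move: E; rewrite /a /a2 s2 !Laplace_Ex_expsum// /dexpsum !big_map mulr_sumr => /eqP.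
rewrite -subr_eq0 -sumrB => /eqP E; rewrite -[RHS]E.
by apply: eq_bigr => p _ /=; ring.
Qed.

End laplace_exponent.

(** * The transform in time of the exponential moments *)

Section subordinator_transform.
Context {R : realType} {d : measure_display} {Omega : measurableType d}.
Variables (P : probability Omega R) (T : R -> Omega -> R) (alpha : R).
Hypothesis halpha : 0 < alpha <= 1.
Hypothesis hT : forall t, 0 < t -> measurable_fun setT (T t) /\ forall w, 0 <= T t w.
Hypothesis hfold : folded_solution alpha (fun t A => P (T t @^-1` A)).
Implicit Types (s t x m : R).

Local Notation expT := (expT P T).

Lemma Laplace_expT0 s : 0 < s -> Laplace s (expT 0) = s^-1.
Proof.
move=> s0; rewrite (@Laplace_eq _ s _ (fun=> 1)); first by rewrite (Laplace_integrable_cst 1 s0).2 div1r.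
move=> t t0; rewrite /expT /Ex.
under eq_Rintegral do rewrite mul0r oppr0 expR0.
by rewrite Rintegral_cst//= probability_setT mulr1.
Qed.

Lemma Laplace_expT_infty s : 0 < s -> Laplace s (expT n%:R) @[n --> \oo] --> (0 : R).
Proof.
move=> s0; rewrite -(Laplace_0 s).
apply: (@Laplace_dominated R s 1 (fun n => expT n%:R) (fun=> 0) s0 _ _ _).2.
- move=> n; apply: continuous_measurable_pos => t.
  exact: (expT_continuous halpha hT hfold).
- by move=> n t; exact: (expT_bounded P hT).
- move=> t t0.
  have c0 : Ex P T (cst 0) t = 0 by rewrite /Ex Rintegral_cst// mul0r.
  rewrite -[X in _ --> X]c0; apply: (Ex_cvg (M := 1) hT hfold t0).
  + by move=> n; exact: measurable_expRNM.
  + exact: measurable_cst.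
  + by move=> n x; exact: expRN_bounded.
  + move=> x x0 /=.
    have -> : (fun n : nat => expR (- (n%:R * x))) = (fun n => expR (- x) ^+ n).
      by apply/funext => n; rewrite -expRM_natl mulrN.
    by apply: cvg_expr; rewrite ger0_norm ?expR_ge0// expR_lt1 oppr_lt0.
Qed.

(** The transform in t of the law of T(t) is a weak solution V of
    V'' = s^(2 alpha) V on the open half-line.  Tested against the combination
    of exp(-p x), for p among 0, r, m, K, that vanishes to second order at 0
    (its coefficients are those of a divided difference, and r = s^alpha is
    annihilated), it determines the transform at m once K tends to infinity. *)
Lemma Laplace_expT s m : 0 < s -> 0 < m -> m != s `^ alpha ->
  Laplace s (expT m) = s `^ alpha / s / (s `^ alpha + m).
Proof.
move=> s0 m0; set r := s `^ alpha => mr.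
have r0 : 0 < r by exact: powR_gt0.
pose L p := Laplace s (expT p).
have EL l : flat l -> \sum_(p <- l) p.1 * (r ^+ 2 - p.2 ^+ 2) * L p.2 = 0.
  exact: (Laplace_expsum halpha hT hfold).
have L0 : L 0 = s^-1 by exact: Laplace_expT0.
have Linf : L n%:R @[n --> \oo] --> (0 : R) by exact: Laplace_expT_infty.
rewrite -/(L m); clearbody L; clearbody r.
have key (K : R) : r < K -> m < K -> (m + r) * L m - r / s =
    - (m * r / s) * K^-1 + m * (1 + r * K^-1) * L K.
  move=> rK mK.
  have K0 : 0 < K by exact: lt_trans rK.
  pose l : seq (R * R) := [:: (- (r * m * K)^-1, 0); ((r * (r - m) * (r - K))^-1, r);
    ((m * (m - r) * (m - K))^-1, m); ((K * (K - r) * (K - m))^-1, K)].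
  have n1 : r != 0 by rewrite gt_eqF.
  have n2 : m != 0 by rewrite gt_eqF.
  have n3 : K != 0 by rewrite gt_eqF.
  have n4 : r - m != 0 by rewrite subr_eq0 eq_sym.
  have n5 : r - K != 0 by rewrite subr_eq0 lt_eqF.
  have n6 : m - r != 0 by rewrite subr_eq0.
  have n7 : m - K != 0 by rewrite subr_eq0 lt_eqF.
  have n8 : K - r != 0 by rewrite subr_eq0 gt_eqF.
  have n9 : K - m != 0 by rewrite subr_eq0 gt_eqF.
  have fl : flat l.
    split.
    - by rewrite /= lexx (ltW r0) (ltW m0) (ltW K0).
    - rewrite /expsum /l !big_cons big_nil /= !mulr0 oppr0 expR0; field.
      by rewrite ?n1 ?n2 ?n3 ?n4 ?n5 ?n6 ?n7 ?n8 ?n9.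
    - rewrite /expsum /dexpsum /l !big_cons big_nil /= !mulr0 oppr0 expR0; field.
      by rewrite ?n1 ?n2 ?n3 ?n4 ?n5 ?n6 ?n7 ?n8 ?n9.
    - rewrite /expsum /dexpsum /l !big_cons big_nil /= !mulr0 oppr0 expR0; field.
      by rewrite ?n1 ?n2 ?n3 ?n4 ?n5 ?n6 ?n7 ?n8 ?n9.
  have := EL l fl.
  rewrite /l !big_cons big_nil /= L0 subrr mulr0 mul0r add0r addr0.
  move=> E.
  apply/eqP; rewrite -subr_eq0; apply/eqP.
  rewrite -[RHS](mulr0 (m * (K - m))) -E; field.
  by rewrite ?n1 ?n2 ?n3 ?n4 ?n5 ?n6 ?n7 ?n8 ?n9 gt_eqF.
have lim : - (m * r / s) * n%:R^-1 + m * (1 + r * n%:R^-1) * L n%:R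
    @[n --> \oo] --> - (m * r / s) * 0 + m * (1 + r * 0) * 0.
  have h : (n%:R^-1 : R) @[n --> \oo] --> (0 : R).
    by rewrite -(cvg_shiftS (fun n => n%:R^-1 : R)); exact: cvg_harmonic.
  apply: cvgD; first by apply: cvgM; [exact: cvg_cst|exact: h].
  apply: cvgM; last exact: Linf.
  apply: cvgM; first exact: cvg_cst.
  by apply: cvgD; [exact: cvg_cst|apply: cvgM; [exact: cvg_cst|exact: h]].
rewrite !mulr0 addr0 in lim.
have lim' : (fun=> (m + r) * L m - r / s) @ \oo --> (0 : R).
  apply: cvg_trans lim; apply: near_eq_cvg; near=> n.
  by rewrite -key//; near: n; exact: nbhs_infty_gtr.
have E : 0 = (m + r) * L m - r / s.
  by apply: cvg_unique lim' _; [exact: Rhausdorff|exact: cvg_cst].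
have {E} -> : r / s = (m + r) * L m by apply/esym/eqP; rewrite -subr_eq0 -E.
rewrite addrC [_ * L m]mulrC mulfK//.
by rewrite gt_eqF// addr_gt0.
Unshelve. all: by end_near. Qed.

End subordinator_transform.

(** * Distinctness of the rates and partial fractions *)

Section theta_ones.
Context {R : realType}.

(** Taking i = 1 at each step of the recursion gives the tuple of ones.  For a
    tuple without zeros no index is removed from {0, ..., m}, so these tuples
    alone make all the total rates from n0 on distinct. *)
Lemma Theta_nowhere0 (m p k : nat) : p = m.+1 -> (1 <= k)%N ->
  exists2 x : 'rV[R]_p, Theta k x & forall l, x 0 l != 0.
Proof.
elim: m p k => [|m IHm] p k -> k1.
  exists (unit_row 1 1); first exact: Theta_one.
  by move=> l; rewrite mxE ord1 eqxx oner_eq0.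
have ext (x : 'rV[R]_(m.+2 - 1)) : (forall l, x 0 l != 0) -> forall l,
    (x *m (pid_mx (m.+2 - 1) : 'M[R]_(m.+2 - 1, m.+2)) +
     1%:R *: unit_row m.+2 (m.+2 - 1 + 1)) 0 l != 0.
  move=> x0 l; rewrite !mxE mul1r subnK// eqSS.
  have [lm|lm] := eqVneq (l : nat) m.+1.
    rewrite big1 ?add0r ?oner_eq0// => j _; rewrite mxE.
    have jm : (j < m.+1)%N by apply: leq_trans (ltn_ord j) _; rewrite subn1.
    by rewrite lm ltn_eqF// mulr0.
  have lm' : (l < m.+2 - 1)%N.
    by rewrite subn1/= ltn_neqAle lm/= -ltnS ltn_ord.
  rewrite addr0 (bigD1 (Ordinal lm'))//= big1 ?addr0.
    by rewrite mxE/= eqxx lm' mulr1.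
  move=> j jl; rewrite mxE; suff /negbTE -> : (j : nat) != l by rewrite mulr0.
  by apply: contra jl => /eqP jl; apply/eqP/val_inj.
have sm : (m.+2 - 1 = m.+1)%N by rewrite subn1.
have [km|km] := leqP k m.+1.
  have [x tx x0] := IHm (m.+2 - 1)%N k sm k1.
  exists (x *m pid_mx (m.+2 - 1) + 1%:R *: unit_row m.+2 (m.+2 - 1 + 1)); last exact: ext.
  by apply: Theta_le => //; rewrite ?k1 ?sm.
have [x tx x0] := IHm (m.+2 - 1)%N m.+2 sm isT.
exists (x *m pid_mx (m.+2 - 1) + 1%:R *: unit_row m.+2 (m.+2 - 1 + 1)); last exact: ext.
by apply: Theta_ge.
Qed.

Lemma Lambda_seq_nowhere0 m (x : 'rV[R]_m) : (forall l, x 0 l != 0) ->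
  Lambda_seq x = iota 0 m.+1.
Proof.
move=> x0; rewrite /Lambda_seq; have -> : Lambda x = [set: 'I_m.+1]%SET.
  apply/setP => j; rewrite !inE; apply/negP => /imsetP[l].
  by rewrite inE (negbTE (x0 l)) andbF.
by rewrite enum_setT -enumT val_enum_ord.
Qed.

End theta_ones.

Section partial_fractions.
Context {R : realType}.
Variables (k n0 : nat) (lambda : nat -> nat -> R).

Definition rate n : R := \sum_(1 <= i < k.+1) lambda n i.

Hypothesis rate_inj : forall i j, (n0 <= i)%N -> (i < j)%N -> rate i != rate j.

(** The forward equations after Laplace transformation: z = s^alpha and
    A = s^alpha / s for the process of order alpha. *)
Definition birth_recursion (z A : R) (L : nat -> R) :=
  [/\ forall n, (n0 <= n)%N -> z + rate n != 0, forall n, (n < n0)%N -> L n = 0 &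
   forall n, (n0 <= n)%N -> (z + rate n) * L n = A * (n == n0)%:R +
     \sum_(1 <= i < (minn n k).+1) lambda (n - i)%N i * L (n - i)%N].

(** Induction on n, splitting 1 / ((z + mu_n) (z + mu_j)) into partial fractions.
    The order of the quantifiers is the point: the coefficients serve all z and
    A at once, hence both the fractional and the ordinary process. *)
Lemma birth_partial_fractions n : (n0 <= n)%N ->
  exists c : nat -> R, forall z A L, birth_recursion z A L ->
    L n = \sum_(n0 <= j < n.+1) c j * (A / (z + rate j)).
Proof.
elim/ltn_ind: n => n IH n0n.
have /boolp.choice [C HC] : forall m, exists c : nat -> R, (m < n)%N -> (n0 <= m)%N ->
    forall z A L, birth_recursion z A L ->
    L m = \sum_(n0 <= j < m.+1) c j * (A / (z + rate j)).
  move=> m.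
  have [mn|mn] := ltnP m n; last by exists (fun=> 0).
  have [nm|nm] := leqP n0 m; last by exists (fun=> 0).
  by have [c hc] := IH m mn nm; exists c.
pose e i j := if (n0 <= n - i)%N && (j <= n - i)%N then C (n - i)%N j else 0.
pose D j := \sum_(1 <= i < (minn n k).+1) lambda (n - i)%N i * e i j.
pose b j := D j / (rate n - rate j).
exists (fun j => if j == n then (n == n0)%:R - \sum_(n0 <= j < n) b j else b j).
move=> z A L hL; have [zr L0 Lr] := hL.
have S : \sum_(1 <= i < (minn n k).+1) lambda (n - i)%N i * L (n - i)%N =
    \sum_(n0 <= j < n) D j * (A / (z + rate j)).
  under [RHS]eq_bigr do rewrite mulr_suml.
  rewrite [RHS]exchange_big/= [LHS]big_nat [RHS]big_nat; apply: eq_bigr => i /andP[i1 ik].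
  under [RHS]eq_bigr do rewrite -mulrA; rewrite -mulr_sumr; congr (_ * _).
  have nin : (n - i < n)%N.
    rewrite ltn_subrL i1/=; move: ik; rewrite ltnS leq_min => /andP[iN _].
    exact: leq_trans iN.
  have [h|h] := leqP n0 (n - i); last first.
    by rewrite L0// big1// => j _; rewrite /e leqNgt h mul0r.
  rewrite (HC _ nin h _ _ _ hL) [RHS](big_cat_nat _ (n := (n - i).+1)) ?leqW//=.
  rewrite [X in _ = _ + X]big_nat [X in _ = _ + X]big1 ?addr0; last first.
    by move=> j /andP[ij _]; rewrite /e h/= leqNgt ij mul0r.
  rewrite big_nat [RHS]big_nat; apply: eq_bigr => j /andP[_ ij].
  by rewrite /e h/= -ltnS ij.
have zn := zr n n0n.
apply: (mulfI zn); rewrite Lr// S big_nat_recr//= eqxx mulrDr.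
have -> : \sum_(n0 <= j < n) (if j == n then (n == n0)%:R - \sum_(n0 <= j0 < n) b j0 else b j)
      * (A / (z + rate j)) = \sum_(n0 <= j < n) b j * (A / (z + rate j)).
  by rewrite big_nat [RHS]big_nat; apply: eq_bigr => j /andP[_ jn]; rewrite ltn_eqF.
rewrite [X in _ = _ + X](_ : _ = A * (n == n0)%:R - A * \sum_(n0 <= j < n) b j); last first.
  by field.
rewrite addrCA; congr (_ + _).
rewrite !mulr_sumr -sumrB big_nat [RHS]big_nat; apply: eq_bigr => j /andP[nj jn].
have zj := zr j nj; have d : rate n - rate j != 0 by rewrite subr_eq0 eq_sym rate_inj.
by rewrite /b; field; rewrite zj d.
Qed.

End partial_fractions.

(** * State probabilities of birth processes *)

Section birth_process_transform.
Context {R : realType} {d : measure_display} {Omega : measurableType d}.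
Variables (k n0 : nat) (alpha : R) (lambda : nat -> nat -> R).
Variables (P : probability Omega R) (X : R -> Omega -> state).
Hypothesis halpha : 0 < alpha <= 1.
Hypothesis rate_gt0 : forall n, (n0 <= n)%N -> 0 < rate k lambda n.
Hypothesis hX : is_GFBP k n0 alpha lambda P X.

Local Notation p := (state_prob P X).

Lemma measurable_state n t : 0 <= t -> measurable (X t @^-1` [set Some n]).
Proof.
have [mX _ _ _] := hX; move=> t0.
by rewrite -[X in measurable X]setTI; apply: mX.
Qed.

Lemma state_prob01 n t : 0 <= t -> 0 <= p n t <= 1.
Proof.
move=> t0; have mX := measurable_state n t0; rewrite /state_prob fine_ge0//=.
by rewrite -lee_fin fineK ?fin_num_measure// probability_le1.
Qed.

Lemma state_prob_norm n t : 0 < t -> `|p n t| <= 1.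
Proof. by move=> t0; have /andP[h1 h2] := state_prob01 n (ltW t0); rewrite ger0_norm. Qed.

Lemma state_prob_continuous n t : (n0 <= n)%N -> 0 < t -> {for t, continuous (p n)}.
Proof.
move=> nn; have [_ _ _ /(_ n nn)[cd c0 _]] := hX.
have [dk _] := cd; have H := dk 0%N.
rewrite caputo_order1// in H; have {}H := H isT.
apply: (@primitive_continuous _ _ (derive1n 1 (p n)) (p n 0)).
  by move=> v v0; exact: (H v v v0 (lexx v)).1.
exact: (primitive_from_0 H c0).
Qed.

Lemma Laplace_integrable_state_prob n s : 0 < s -> Laplace_integrable s (p n).
Proof.
move=> s0; have [nn|nn] := leqP n0 n.
  apply: (Laplace_integrable_bounded s0) => [|t]; last exact: state_prob_norm.
  by apply: continuous_measurable_pos => t; exact: state_prob_continuous.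
have [_ z _ _] := hX.
by apply: Laplace_integrable_eq (Laplace_integrable_0 s) => t t0; rewrite z// ltW.
Qed.

(** By the forward equation itself the Caputo derivative is bounded, since the
    state probabilities are; this is what [Caputo_Laplace] asks for. *)
Lemma GFBP_recursion s : 0 < s ->
  birth_recursion k n0 lambda (s `^ alpha) (s `^ alpha / s) (fun n => Laplace s (p n)).
Proof.
move=> s0; have r0 : 0 < s `^ alpha by exact: powR_gt0.
have [_ z [p0 p1] eqs] := hX.
split.
- by move=> n nn; rewrite gt_eqF// addr_gt0// rate_gt0.
- by move=> n nn; rewrite -[RHS](Laplace_0 s); apply: Laplace_eq => t t0; rewrite z// ltW.
move=> n nn; have [cd c0 ce] := eqs n nn.
pose S t := \sum_(1 <= i < (minn n k).+1) lambda (n - i)%N i * p (n - i)%N t.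
have iS : Laplace_integrable s S /\ Laplace s S = \sum_(1 <= i < (minn n k).+1) lambda (n - i)%N i * Laplace s (p (n - i)%N).
  have [iS LS] := @Laplace_integrable_sum R s _ (index_iota 1 (minn n k).+1) xpredT
    (fun i t => lambda (n - i)%N i * p (n - i)%N t)
    (fun i _ => Laplace_integrable_Z (lambda (n - i)%N i) (Laplace_integrable_state_prob (n - i)%N s0)).
  by split => //; rewrite LS; apply: eq_bigr => i _; rewrite LaplaceZ//; exact: Laplace_integrable_state_prob.
have E t : 0 < t -> - rate k lambda n * p n t + S t = caputo alpha (p n) t.
  by move=> t0; rewrite ce// mulNr /rate mulr_suml.
pose M := rate k lambda n + \sum_(1 <= i < (minn n k).+1) `|lambda (n - i)%N i|.
have gM t : 0 < t -> `|caputo alpha (p n) t| <= M.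
  move=> t0; rewrite -E// (le_trans (ler_normD _ _))// lerD//.
    by rewrite normrM normrN (gtr0_norm (rate_gt0 nn)) ler_piMr ?state_prob_norm// ltW// rate_gt0.
  rewrite (le_trans (ler_norm_sum _ _ _))// ler_sum// => i _.
  by rewrite normrM ler_piMr// state_prob_norm.
have ab : 0 < alpha <= 2 by case/andP: halpha => a0 a1; rewrite a0/= (le_trans a1)// ler1n.
have a1 : 1 < alpha -> derive1n 1 (p n) t @[t --> 0^'+] --> (0 : R).
  by case/andP: halpha => _ h /lt_le_trans/(_ h); rewrite ltxx.
have [_ LL] := Caputo_Laplace ab s0 cd c0 a1 gM.
have Lg : Laplace s (caputo alpha (p n)) = - rate k lambda n * Laplace s (p n) +
    \sum_(1 <= i < (minn n k).+1) lambda (n - i)%N i * Laplace s (p (n - i)%N).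
  rewrite -(Laplace_eq s E) LaplaceD ?iS.1 ?iS.2//; last by apply: Laplace_integrable_Z; exact: Laplace_integrable_state_prob.
  by rewrite LaplaceZ//; exact: Laplace_integrable_state_prob.
have -> : (n == n0)%:R = p n 0.
  have [->|ne] := eqVneq n n0; first by rewrite p0.
  by rewrite p1// ltn_neqAle eq_sym ne.
rewrite mulrDl {1}LL Lg powRN.
by field; rewrite !gt_eqF.
Qed.

End birth_process_transform.

Lemma continuous_at_sum {R : realType} (I : eqType) (r : seq I) (F : I -> R -> R) (t : R) :
  (forall i, i \in r -> {for t, continuous (F i)}) ->
  {for t, continuous (fun t => \sum_(i <- r) F i t)}.
Proof.
elim: r => [_|i r IHr cF].
  rewrite (_ : (fun t => _) = cst 0); first exact: cvg_cst.
  by apply/funext => v; rewrite big_nil.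
rewrite (_ : (fun t => _) = (fun t => F i t + \sum_(j <- r) F j t)); last first.
  by apply/funext => v; rewrite big_cons.
apply: cvgD; first by apply: cF; rewrite mem_head.
by apply: IHr => j jr; apply: cF; rewrite in_cons jr orbT.
Qed.

Section birth_process_mixture.
Context {R : realType} {d : measure_display} {Omega : measurableType d}.
Variables (k n0 : nat) (lambda : nat -> nat -> R).
Variables (P : probability Omega R) (X : R -> Omega -> state).
Hypothesis rate_gt0 : forall n, (n0 <= n)%N -> 0 < rate k lambda n.
Hypothesis hX : is_GFBP k n0 1 lambda P X.

Lemma expR_continuous_at (m t : R) : {for t, continuous (fun x : R => expR (- (m * x)))}.
Proof.
apply: continuous_comp; last exact: continuous_expR.
by apply: (@continuousN _ R^o); exact: mulrl_continuous.
Qed.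

Lemma Laplace_expR (s m : R) : 0 < s -> 0 < m ->
  Laplace_integrable s (fun x => expR (- (m * x))) /\ Laplace s (fun x => expR (- (m * x))) = (s + m)^-1.
Proof.
move=> s0 m0; have sm : 0 < s + m by rewrite addr_gt0.
have [i1 L1] := Laplace_integrable_cst 1 sm.
have E (x : R) : expR (- ((s + m) * x)) * 1 = expR (- (s * x)) * expR (- (m * x)).
  by rewrite mulr1 -expRD; congr expR; ring.
split.
  by apply: eq_integrable i1 => // x _; rewrite /= E.
by rewrite -div1r -L1; apply: eq_Rintegral => x _; rewrite E.
Qed.

(** For alpha = 1, A / (z + mu_j) = 1 / (s + mu_j) is the transform of an
    exponential, so the uniqueness of the transform identifies the state
    probability. *)
Lemma GBP_mixture n (c : nat -> R) : (n0 <= n)%N ->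
  (forall z A L, birth_recursion k n0 lambda z A L ->
     L n = \sum_(n0 <= j < n.+1) c j * (A / (z + rate k lambda j))) ->
  forall t, 0 < t -> state_prob P X n t =
    \sum_(n0 <= j < n.+1) c j * expR (- (rate k lambda j * t)).
Proof.
move=> nn hc; have one01 : 0 < (1 : R) <= 1 by rewrite ltr01 lexx.
pose g t : R := \sum_(n0 <= j < n.+1) c j * expR (- (rate k lambda j * t)).
have rj j : j \in index_iota n0 n.+1 -> 0 < rate k lambda j.
  by rewrite mem_index_iota => /andP[h _]; exact: rate_gt0.
apply: (@Laplace_unique _ _ g 1 (\sum_(n0 <= j < n.+1) `|c j|) 1) => //.
- by move=> t; exact: (state_prob_continuous one01 hX).
- move=> t t0; apply: continuous_at_sum => j _.
  by apply: cvgM; [exact: cvg_cst|exact: expR_continuous_at].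
- by move=> t; exact: (state_prob_norm hX).
- move=> t t0; rewrite (le_trans (ler_norm_sum _ _ _))//.
  rewrite big_seq [leRHS]big_seq; apply: ler_sum => j /rj r0.
  by rewrite normrM ler_piMr// expRN_bounded// ltW.
move=> s s1; have s0 : 0 < s by exact: lt_le_trans s1.
have := GFBP_recursion one01 rate_gt0 hX s0.
rewrite powRr1 ?ltW// => /hc ->; rewrite divff ?gt_eqF// /g.
rewrite big_seq (@Laplace_eq _ s (fun t => \sum_(n0 <= j < n.+1) c j * expR (- (rate k lambda j * t)))
  (fun t => \sum_(j <- index_iota n0 n.+1 | j \in index_iota n0 n.+1)
     c j * expR (- (rate k lambda j * t)))); last by move=> t _; rewrite big_seq.
have [_ ->] := @Laplace_integrable_sum R s _ (index_iota n0 n.+1) (fun j => j \in index_iota n0 n.+1)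
  (fun j t => c j * expR (- (rate k lambda j * t)))
  (fun j hj => Laplace_integrable_Z (c j) (Laplace_expR s0 (rj j hj)).1).
apply: eq_bigr => j hj; have [i1 L1] := Laplace_expR s0 (rj j hj).
by rewrite LaplaceZ// L1 div1r.
Qed.

End birth_process_mixture.

(** * Composition with an independent random time *)

Lemma indic_le1 {R : realType} {V : Type} (D : set V) w : `|\1_D w : R| <= 1.
Proof. by rewrite indicE; case: (_ \in _); rewrite /= ?normr1 ?normr0. Qed.

Section composition.
Context {R : realType} {d : measure_display} {Omega : measurableType d}.
Variables (P : probability Omega R) (X : R -> Omega -> state) (T : R -> Omega -> R).
Variables (t : R) (n : nat) (r : seq nat) (c m : nat -> R).
Hypothesis t0 : 0 < t.
Hypothesis mX : forall v, 0 <= v -> measurable_fun setT (X v).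
Hypothesis cX : forall w v, 0 <= v -> \forall s \near v^'+, X s w = X v w.
Hypothesis hT : forall v, 0 < v -> measurable_fun setT (T v) /\ forall w, 0 <= T v w.
Hypothesis indep : independent_processes P `[0, +oo[ X `]0, +oo[ T.
Hypothesis m0 : forall j, j \in r -> 0 <= m j.
Hypothesis pE : forall x, 0 < x ->
  state_prob P X n x = \sum_(j <- r) c j * expR (- (m j * x)).

Local Notation Xn v := (X v @^-1` [set Some n]).

(* On the k-th cell of the grid of mesh 1/(N+1), T(t) is replaced by the right
   end point of the cell, which is larger than T(t): this is the side on which
   the paths of X are continuous. *)
Let cell (N k : nat) : set Omega :=
  T t @^-1` `[k%:R / N.+1%:R, k.+1%:R / N.+1%:R[.

Let idx N w : nat := Num.truncn (T t w * N.+1%:R).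

Let Tgrid N w : R := (idx N w).+1%:R / N.+1%:R.

Let T0 w : 0 <= T t w. Proof. exact: (hT t0).2. Qed.

Let in_cell N k w : cell N k w <-> idx N w = k.
Proof.
rewrite /cell /idx /= in_itv/= ler_pdivrMr// ltr_pdivlMr//.
split => [/truncn_def//|<-]; apply: truncn_itv.
by rewrite mulr_ge0.
Qed.

Let mcell N k : measurable (cell N k).
Proof. by rewrite /cell -[X in measurable X]setTI; apply: (hT t0).1. Qed.

Let cell_cover N : \bigcup_k cell N k = setT.
Proof. by apply/seteqP; split => // w _; exists (idx N w) => //; apply/in_cell. Qed.

Let cell_disj N : trivIset setT (cell N).
Proof.
apply/trivIsetP => i j _ _ ij; apply/seteqP; split => // w [/in_cell wi /in_cell wj].
by move: ij; rewrite -wi -wj eqxx.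
Qed.

Let Tgrid_cell N k w : cell N k w -> Tgrid N w = k.+1%:R / N.+1%:R.
Proof. by move/in_cell => E; rewrite /Tgrid E. Qed.

Let Tgrid_gt N w : T t w < Tgrid N w.
Proof. by rewrite /Tgrid ltr_pdivlMr// truncnS_gt. Qed.

Let Tgrid_le N w : Tgrid N w - T t w <= N.+1%:R^-1.
Proof.
rewrite /Tgrid /idx lerBlDr ler_pdivrMr// mulrDl mulVf ?pnatr_eq0// -natr1 addrC lerD2l.
by rewrite truncn_le mulr_ge0.
Qed.

Let Tgrid_cvg w : Tgrid N w @[N --> \oo] --> T t w.
Proof.
apply/cvgrPdist_le => e e0.
have h : (N.+1%:R^-1 : R) @[N --> \oo] --> (0 : R) by exact: cvg_harmonic.
move/cvgrPdist_le : h => /(_ e e0); apply: filterS => N.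
rewrite sub0r normrN ger0_norm ?invr_ge0// => Ne.
rewrite distrC ger0_norm ?subr_ge0 ?(ltW (Tgrid_gt _ _))//.
exact: le_trans (Tgrid_le _ _) Ne.
Qed.

Let mTgrid N : measurable_fun setT (Tgrid N).
Proof.
rewrite -(cell_cover N); apply/measurable_fun_bigcup => // k.
apply: (@eq_measurable_fun _ _ _ _ _ (fun _ : Omega => k.+1%:R / N.+1%:R : R)); last exact: measurable_cst.
by move=> w; rewrite inE => /Tgrid_cell ->.
Qed.

Let grid_pos N k : 0 < k.+1%:R / N.+1%:R :> R.
Proof. by rewrite divr_gt0. Qed.

Let l : seq (R * R) := [seq (c j, m j) | j <- r].

Let l0 : all (fun p => 0 <= p.2) l.
Proof. by apply/allP => _ /mapP[j jr ->]; exact: m0. Qed.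

Let SE x : \sum_(j <- r) c j * expR (- (m j * x)) = expsum l x.
Proof. by rewrite /expsum big_map. Qed.

Let mXn v : 0 <= v -> measurable (Xn v).
Proof. by move=> v0; rewrite -[X in measurable X]setTI; apply: mX. Qed.

Let PXn v : 0 < v -> P (Xn v) = (expsum l v)%:E.
Proof.
move=> v0; rewrite -SE -pE// /state_prob fineK// fin_num_measure//.
exact: mXn (ltW v0).
Qed.

Let A N : set Omega := [set w | X (Tgrid N w) w = Some n].
Let B : set Omega := [set w | X (T t w) w = Some n].

Let AE N : A N = \bigcup_k (cell N k `&` Xn (k.+1%:R / N.+1%:R)).
Proof.
apply/seteqP; split => w.
  move=> Aw; exists (idx N w) => //.
  by have h : cell N (idx N w) w; [exact/in_cell|split => //; rewrite /= -(Tgrid_cell h)].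
by move=> [k _ [/Tgrid_cell h Xw]]; rewrite /A /= h.
Qed.

Let mA N : measurable (A N).
Proof.
rewrite AE; apply: bigcupT_measurable => k; apply: measurableI => //.
exact: mXn (ltW (grid_pos N k)).
Qed.

Let PA N : P (A N) = (\int[P]_w (expsum l (Tgrid N w))%:E)%E.
Proof.
have S0 w : 0 <= expsum l (Tgrid N w).
  have Tp : 0 < Tgrid N w by exact: le_lt_trans (T0 w) (Tgrid_gt N w).
  by rewrite -lee_fin -PXn// measure_ge0.
have mS : measurable_fun setT (fun w => expsum l (Tgrid N w)).
  by apply: (measurableT_comp (continuous_measurable_fun (@continuous_expsum R l))).
rewrite AE measure_semi_bigcup//=; last 3 first.
- by move=> k; apply: measurableI => //; exact: mXn (ltW (grid_pos N k)).
- exact/trivIset_setIr/cell_disj.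
- by rewrite -AE.
rewrite -(cell_cover N) ge0_integral_bigcup//=; last 2 first.
- by apply/measurable_EFinP; exact: measurable_funTS.
- by move=> w _; rewrite lee_fin.
apply: eq_eseriesr => k _.
rewrite setIC indep; last 2 first.
- apply: sub_sigma_algebra; exists (k.+1%:R / N.+1%:R), [set Some n]; split => //.
  by rewrite /= in_itv/= andbT ltW.
- apply: sub_sigma_algebra; exists t, `[k%:R / N.+1%:R, k.+1%:R / N.+1%:R[%classic; split => //.
  by rewrite /= in_itv/= andbT.
rewrite PXn// (eq_integral (cst (expsum l (k.+1%:R / N.+1%:R))%:E)); last first.
  by move=> w; rewrite inE => /Tgrid_cell ->.
by rewrite integral_cst.
Qed.

Let A_cvg w : \1_(A N) w @[N --> \oo] --> (\1_B w : R).
Proof.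
have [e /= e0 he] : exists2 e : R, 0 < e & forall s, `|T t w - s| < e -> T t w < s -> X s w = X (T t w) w.
  by have := cX w (T0 w) => /nbhs_ballP[e e0 h]; exists e => // s h1 h2; exact: h.
apply: cvg_near_cst.
have h : (N.+1%:R^-1 : R) @[N --> \oo] --> (0 : R) by exact: cvg_harmonic.
move/cvgrPdist_lt : h => /(_ e e0); apply: filterS => N.
rewrite sub0r normrN ger0_norm ?invr_ge0// => Ne.
have E : X (Tgrid N w) w = X (T t w) w.
  apply: he => //; rewrite distrC ger0_norm ?subr_ge0 ?(ltW (Tgrid_gt _ _))//.
  exact: le_lt_trans (Tgrid_le _ _) Ne.
by rewrite !indicE; congr (nat_of_bool _)%:R; apply/idP/idP; rewrite !inE /A /B /= E.
Qed.

(** X is right-continuous and independent of T(t), so conditioning on a grid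
    from the right and refining it gives P(X(T(t)) = n) = E[p(n, T(t))]. *)
Lemma prob_subordinated :
  measurable [set w | X (T t w) w = Some n] /\
  P [set w | X (T t w) w = Some n] = (\sum_(j <- r) c j * expT P T (m j) t)%:E.
Proof.
have m1A N : measurable_fun setT (\1_(A N) : Omega -> R) by exact: measurable_indic.
have m1B : measurable_fun setT (\1_B : Omega -> R).
  by apply: measurable_fun_cvg m1A _ => // w _; exact: A_cvg.
have mB : measurable B by apply/(@measurable_indicP _ _ R).
split => //.
have i1 : P.-integrable setT (EFin \o cst (1 : R)) by exact: finite_measure_integrable_cst.
have aeA : {ae P, forall w, setT w -> \1_(A N) w @[N --> \oo] --> (\1_B w : R)}.
  by apply: aeW => w _; exact: A_cvg.
have [_ LA] := Rintegral_dominated measurableT m1A m1B aeA i1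
  (fun N w _ => indic_le1 (A N) w).
have mS (f : Omega -> R) : measurable_fun setT f -> measurable_fun setT (fun w => expsum l (f w)).
  exact: (measurableT_comp (continuous_measurable_fun (@continuous_expsum R l))).
pose C := \sum_(p <- l) `|p.1|.
have iC : P.-integrable setT (EFin \o cst C) by exact: finite_measure_integrable_cst.
have bS N w : `|expsum l (Tgrid N w)| <= C.
  by apply: expsum_bounded => //; rewrite ltW// (le_lt_trans (T0 w)).
have cS w : expsum l (Tgrid N w) @[N --> \oo] --> expsum l (T t w).
  by apply: continuous_cvg; [exact: continuous_expsum|exact: Tgrid_cvg].
have aeS : {ae P, forall w, setT w -> expsum l (Tgrid N w) @[N --> \oo] --> expsum l (T t w)}.
  by apply: aeW => w _; exact: cS.
have [_ LS] := Rintegral_dominated measurableT (fun N => mS _ (mTgrid N)) (mS _ (hT t0).1)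
  aeS iC (fun N w _ => bS N w).
have EA N : \int[P]_w \1_(A N) w = \int[P]_w expsum l (Tgrid N w).
  by rewrite /Rintegral integral_indic//= setIT PA.
have E : \int[P]_w \1_B w = \int[P]_w expsum l (T t w).
  apply: cvg_unique LA _; first exact: Rhausdorff.
  by apply: cvg_trans LS; apply: near_eq_cvg; apply: nearW => N; rewrite EA.
have PB : P B = (\int[P]_w \1_B w)%:E.
  by rewrite /Rintegral integral_indic//= setIT fineK// fin_num_measure.
rewrite -/B PB E -/(Ex P T (expsum l) t) Ex_expsum//.
by rewrite big_map.
Qed.

End composition.

(** * Equality of the two laws *)

Section state_laws.
Context {R : realType} {d : measure_display} {Omega : measurableType d}.
Variables (P : probability Omega R) (Y : Omega -> state).
Hypothesis mY : forall n, measurable (Y @^-1` [set Some n]).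

Let fiber (B : set state) : ~ B None ->
  Y @^-1` B = \bigcup_(n in [set n | B (Some n)]) (Y @^-1` [set Some n]).
Proof.
move=> BN; apply/seteqP; split => w /=.
  by case E : (Y w) => [n|//] Bn; exists n.
by move=> [n Bn /= ->].
Qed.

Let mfiber B : ~ B None -> measurable (Y @^-1` B).
Proof. by move=> BN; rewrite fiber//; apply: bigcup_measurable. Qed.

(** A set of states without the point at infinity has a countable union of
    fibres as preimage; any other set is the complement of such a set. *)
Lemma state_preimage_measurable B : measurable (Y @^-1` B).
Proof.
have [BN|/mfiber//] := pselect (B None).
rewrite -(setCK (_ @^-1` _)); apply: measurableC.
exact: (@mfiber (~` B) (fun h => h BN)).
Qed.

Lemma state_measurable_fun : measurable_fun setT Y.
Proof. by move=> _ B _; rewrite setTI; exact: state_preimage_measurable. Qed.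

Lemma state_law B : ~ B None ->
  P (Y @^-1` B) = (\sum_(n <oo | n \in [set n | B (Some n)]) P (Y @^-1` [set Some n]))%E.
Proof.
move=> BN; rewrite fiber// measure_bigcup//.
by apply/trivIsetP => i j _ _ ij; apply/seteqP; split => // w [/= ->] [] /eqP; rewrite (negbTE ij).
Qed.

End state_laws.

(** The point at infinity carries the mass that the finite states leave out. *)
Lemma state_law_eq {R : realType} {d d' : measure_display}
    {Omega : measurableType d} {Omega' : measurableType d'}
    (P : probability Omega R) (P' : probability Omega' R)
    (Y : Omega -> state) (Y' : Omega' -> state) :
  (forall n, measurable (Y @^-1` [set Some n])) ->
  (forall n, measurable (Y' @^-1` [set Some n])) ->
  (forall n, P (Y @^-1` [set Some n]) = P' (Y' @^-1` [set Some n])) ->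
  forall B, P (Y @^-1` B) = P' (Y' @^-1` B).
Proof.
move=> mY mY' E.
have half B : ~ B None -> P (Y @^-1` B) = P' (Y' @^-1` B).
  by move=> BN; rewrite !state_law//; apply: eq_eseriesr => n _; exact: E.
move=> B; have [BN|/half//] := pselect (B None).
rewrite -(setCK (Y @^-1` B)) -(setCK (Y' @^-1` B)).
have h := half (~` B) (fun h => h BN).
have mC := state_preimage_measurable mY (~` B).
have mC' := state_preimage_measurable mY' (~` B).
by rewrite [LHS](probability_setC P mC) [RHS](probability_setC P' mC'); congr (1 - _)%E.
Qed.

Section fractional_mixture.
Context {R : realType} {d d' : measure_display}.
Context {Omega : measurableType d} {Omega' : measurableType d'}.
Variables (k n0 : nat) (alpha : R) (lambda : nat -> nat -> R).
Variables (P : probability Omega R) (P' : probability Omega' R).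
Variables (X : R -> Omega' -> state) (T : R -> Omega -> R).
Hypothesis halpha : 0 < alpha <= 1.
Hypothesis rate_gt0 : forall n, (n0 <= n)%N -> 0 < rate k lambda n.
Hypothesis hT : forall t, 0 < t -> measurable_fun setT (T t) /\ forall w, 0 <= T t w.
Hypothesis hfold : folded_solution alpha (fun t A => P (T t @^-1` A)).
Hypothesis hX : is_GFBP k n0 alpha lambda P' X.

(** The two sides have the transform sum_j c_j s^(alpha-1) / (s^alpha + rate j) at
    every s for which s^alpha is none of the rates involved. *)
Lemma GFBP_mixture n (c : nat -> R) : (n0 <= n)%N ->
  (forall z A L, birth_recursion k n0 lambda z A L ->
     L n = \sum_(n0 <= j < n.+1) c j * (A / (z + rate k lambda j))) ->
  forall t, 0 < t ->
    \sum_(n0 <= j < n.+1) c j * expT P T (rate k lambda j) t = state_prob P' X n t.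
Proof.
move=> nn hc; have a0 : 0 < alpha by case/andP: halpha.
have rj j : j \in index_iota n0 n.+1 -> 0 < rate k lambda j.
  by rewrite mem_index_iota => /andP[h _]; exact: rate_gt0.
pose f t : R := \sum_(n0 <= j < n.+1) c j * expT P T (rate k lambda j) t.
(* For s^alpha > S, that is for s >= (1 + S)^(1/alpha), s^alpha exceeds all the rates. *)
pose S := \sum_(n0 <= j < n.+1) rate k lambda j.
have S0 : 0 <= S by rewrite /S big_seq; apply: sumr_ge0 => j /rj /ltW.
have rS j : j \in index_iota n0 n.+1 -> rate k lambda j <= S.
  move=> jr; rewrite /S (big_rem j jr)/= lerDl big_seq; apply: sumr_ge0 => i /mem_rem.
  by move=> /rj /ltW.
have S1 : 0 < 1 + S by rewrite ltr_pwDl.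
apply: (@Laplace_unique _ f (state_prob P' X n) (\sum_(n0 <= j < n.+1) `|c j|) 1
  ((1 + S) `^ alpha^-1)).
- exact: powR_gt0.
- move=> t t0; apply: continuous_at_sum => j /rj r0.
  by apply: cvgM; [exact: cvg_cst|apply: (expT_continuous halpha hT hfold) => //; exact: ltW].
- by move=> t; exact: (state_prob_continuous halpha hX).
- move=> t t0; rewrite (le_trans (ler_norm_sum _ _ _))//.
  rewrite big_seq [leRHS]big_seq; apply: ler_sum => j /rj r0.
  by rewrite normrM ler_piMr// (expT_bounded P hT)// ltW.
- by move=> t; exact: (state_prob_norm hX).
move=> s s1; have s0 : 0 < s by apply: lt_le_trans s1; exact: powR_gt0.
have sS : 1 + S <= s `^ alpha.
  have an0 : alpha != 0 by rewrite gt_eqF.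
  have <- : ((1 + S) `^ alpha^-1) `^ alpha = 1 + S by rewrite -powRrM mulVf// powRr1// ltW.
  by apply: ge0_ler_powR => //; rewrite ?nnegrE ?powR_ge0// ltW.
have ne j : j \in index_iota n0 n.+1 -> rate k lambda j != s `^ alpha.
  by move=> /rS h; rewrite lt_eqF// (lt_le_trans _ sS)// ltr_pwDl.
rewrite (hc _ _ _ (GFBP_recursion halpha rate_gt0 hX s0)).
rewrite [RHS]big_seq (@Laplace_eq _ s f (fun t => \sum_(j <- index_iota n0 n.+1 | j \in index_iota n0 n.+1)
     c j * expT P T (rate k lambda j) t)); last by move=> t _; rewrite /f big_seq.
have iE j : j \in index_iota n0 n.+1 -> Laplace_integrable s (expT P T (rate k lambda j)).
  by move=> /rj r0; apply: (Laplace_integrable_expT halpha hT hfold) => //; exact: ltW.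
have [_ ->] := @Laplace_integrable_sum R s _ (index_iota n0 n.+1) (fun j => j \in index_iota n0 n.+1)
  (fun j t => c j * expT P T (rate k lambda j) t) (fun j hj => Laplace_integrable_Z (c j) (iE j hj)).
apply: eq_bigr => j hj; rewrite LaplaceZ; last exact: iE.
by rewrite (Laplace_expT halpha hT hfold)//; [exact: rj|exact: ne].
Qed.

End fractional_mixture.

Theorem theorem2p3 (R : realType) (k n0 : nat) (alpha : R)
  (lambda : nat -> nat -> R)
  (d d' : measure_display)
  (Omega : measurableType d) (P : probability Omega R)
  (Omega' : measurableType d') (P' : probability Omega' R)
  (X : R -> Omega -> state) (Xalpha : R -> Omega' -> state)
  (T : R -> Omega -> R)
  (hk : (1 <= k)%N)
  (halpha : 0 < alpha <= 1)
  (hlambda : forall n i : nat, (n0 <= n)%N -> (1 <= i <= k)%N -> 0 < lambda n i)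
  (hX : is_GBP k n0 lambda P X)
  (hXalpha : is_GFBP k n0 alpha lambda P' Xalpha)
  (hT : forall t : R, 0 < t ->
     measurable_fun setT (T t) /\ forall w : Omega, 0 <= T t w)
  (hfold : folded_solution alpha (fun t A => P (T t @^-1` A)))
  (hindep : independent_processes P `[0, +oo[ X `]0, +oo[ T)
  (hdistinct : forall (m : nat) (x : 'rV[R]_m), (1 <= m)%N -> Theta k x ->
     uniq [seq \sum_(1 <= i < k.+1) lambda (n0 + j)%N i | j <- Lambda_seq x]) :
  forall t : R, 0 < t ->
    eq_in_distribution P' (Xalpha t) P (fun w => X (T t w) w).
Proof.
have rate_gt0 n : (n0 <= n)%N -> 0 < rate k lambda n.
  move=> nn; rewrite /rate big_nat_recl//; apply: ltr_pwDl; first by rewrite hlambda.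
  rewrite big_nat; apply: sumr_ge0 => i /andP[i1 ik]; rewrite ltW// hlambda//.
have rate_inj i j : (n0 <= i)%N -> (i < j)%N -> rate k lambda i != rate k lambda j.
  move=> ni ij; have nj : (n0 < j)%N by exact: leq_ltn_trans ij.
  have m0 : (0 < j - n0)%N by rewrite subn_gt0.
  have [x tx x0] := @Theta_nowhere0 R (j - n0).-1 (j - n0) k (esym (prednK m0)) hk.
  have := hdistinct _ x m0 tx; rewrite Lambda_seq_nowhere0//.
  move=> U; apply/negP => /eqP E.
  have nthE l : (l <= j - n0)%N -> nth 0 [seq rate k lambda (n0 + j0)%N | j0 <- iota 0 (j - n0).+1] l =
      rate k lambda (n0 + l)%N.
    by move=> lj; rewrite (nth_map 0%N) ?size_iota// nth_iota.
  have lij : (i - n0 < j - n0)%N by rewrite ltn_sub2r.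
  have := nth_uniq 0 _ _ U; rewrite size_map size_iota => /(_ (i - n0)%N (j - n0)%N).
  rewrite !ltnS (ltnW lij) leqnn => /(_ isT isT).
  rewrite !nthE ?leqnn ?(ltnW lij)// !subnKC ?(ltnW nj)// E eqxx.
  by rewrite ltn_eqF.
have [hX1 hXr] := hX.
have [mX zX _ _] := hX1; have [mXa zXa _ _] := hXalpha.
move=> t t0.
have law n : measurable [set w | X (T t w) w = Some n] /\
    P [set w | X (T t w) w = Some n] = P' (Xalpha t @^-1` [set Some n]).
  have Ea : P' (Xalpha t @^-1` [set Some n]) = (state_prob P' Xalpha n t)%:E.
    rewrite /state_prob fineK// fin_num_measure//.
    exact: (measurable_state hXalpha n (ltW t0)).
  have [nn|nn] := leqP n0 n; last first.
    have z0 x : 0 < x -> state_prob P X n x = \sum_(j <- [::] : seq nat) 0 * expR (- (0 * x)).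
      by move=> x0; rewrite big_nil zX// ltW.
    have [] := @prob_subordinated _ _ _ P X T t n [::] (fun=> 0) (fun=> 0) t0 mX hXr hT hindep _ z0.
      by [].
    by move=> mB ->; split => //; rewrite Ea big_nil zXa// ltW.
  have [c hc] := birth_partial_fractions rate_inj nn.
  pose r := index_iota n0 n.+1.
  have rj j : j \in r -> 0 < rate k lambda j.
    by rewrite mem_index_iota => /andP[h _]; exact: rate_gt0.
  have mix := GBP_mixture rate_gt0 hX1 nn hc.
  have [mB ->] := prob_subordinated t0 mX hXr hT hindep (fun j jr => ltW (rj j jr)) mix.
  split => //; rewrite Ea; congr EFin.
  exact: (GFBP_mixture halpha rate_gt0 hT hfold hXalpha nn hc).
split.
- by apply: mXa; exact: ltW.
- by apply: state_measurable_fun => n; exact: (law n).1.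
- move=> B _; apply: state_law_eq => n.
  + exact: (measurable_state hXalpha n (ltW t0)).
  + exact: (law n).1.
  + by rewrite -(law n).2.
Qed.
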